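(* Let $S:[0,1)\to[0,1)$ be an interval translation map and let $\mu$ be a non-atomic $S$-invariant Borel probability measure. Put $J=\operatorname{supp}\mu$. Then $(J,\mu,S)$ is metrically equivalent to a countable interval exchange transformation.
   Context: Interval translation map: a map $S:[0,1)\to[0,1)$ for which there are $0=t_0<t_1<\dots<t_n=1$ and $c_1,\dots,c_n\in\mathbb R$ such that $S(x)=x+c_k\in[0,1)$ for all $x\in I_k=[t_{k-1},t_k)$, $k=1,\dots,n$. $S$-invariance means $\mu(S^{-1}B)=\mu(B)$ for all Borel $B$. The measure $\mu$ is also regarded as a measure on $[0,1]$ with $\mu(\{1\})=0$, and $J$ is its closed support in $[0,1]$; $S$ maps $\mu$-almost every point of $J$ into $J$, and the system $(J,\mu,S)$ is understood modulo $\mu$-null sets. Countable interval exchange transformation (countable IET): a measurable map $R:[0,1]\to[0,1]$ for which there is a countable family of pairwise disjoint open intervals $\{U_m\}$ whose union has full Lebesgue measure, and constants $d_m$, such that $R(u)=u+d_m$ for almost every $u\in U_m$, while the translated intervals $U_m+d_m$ are contained in $[0,1]$ up to endpoints, are pairwise disjoint modulo endpoints, and cover $[0,1]$ modulo a Lebesgue-null set. It is regarded as a measure-preserving system with Lebesgue measure. Metric equivalence: measure-preserving systems $(X,\mathcal B_X,\mu,S)$ and $(Y,\mathcal B_Y,\nu,T)$ on standard Borel probability spaces are metrically equivalent if there exist invariant full-measure sets $X_0\subset X$, $Y_0\subset Y$ and a measurable bijection $\Phi:X_0\to Y_0$ with measurable inverse such that $\Phi_*\mu=\nu$ and $\Phi\circ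 S=T\circ\Phi$ on $X_0$. *)

(* Defs.v *)
From HB Require Import structures.
From mathcomp Require Import all_boot all_order all_algebra.
From mathcomp Require Import all_classical all_reals all_analysis.
Set Implicit Arguments.
Unset Strict Implicit.
Unset Printing Implicit Defensive.
Import Order.TTheory GRing.Theory Num.Theory.
Import numFieldNormedType.Exports.
Local Open Scope classical_set_scope.
Local Open Scope ring_scope.

(* Self-maps of a set X of reals are represented by functions R -> R, of which
   only the values on X matter.  Measures are Borel measures on the line, of
   which only the restriction to the carrier X matters. *)

(* The pieces I_k = [t_(k-1), t_k), k = 1, ..., n, are numbered from 0 here. *)
Definition interval_translation_map (R : realType) (S : R -> R) : Prop :=
  exists (n : nat) (t c : nat -> R),
    [/\ t 0%N = 0, t n = 1,
        forall k, (k < n)%N -> t k < t k.+1 &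
        forall k x, (k < n)%N -> x \in `[t k, t k.+1[ ->
          S x = x + c k /\ x + c k \in `[0, 1[ ].

Definition atom (R : realType)
    (mu : {measure set (measurableTypeR R) -> \bar R}) (A : set R) : Prop :=
  [/\ measurable A, (0 < mu A)%E &
      forall B : set R, measurable B -> B `<=` A -> mu B = 0%E \/ mu B = mu A].

Definition nonatomic (R : realType)
    (mu : {measure set (measurableTypeR R) -> \bar R}) : Prop :=
  forall A : set R, ~ atom mu A.

Definition measure_support (R : realType)
    (mu : {measure set (measurableTypeR R) -> \bar R}) : set R :=
  [set x | forall U : set R, open U -> U x -> (0 < mu U)%E].

Definition invariant_measure_on (R : realType) (X : set R)
    (mu : {measure set (measurableTypeR R) -> \bar R}) (S : R -> R) : Prop :=
  forall B : set R, measurable B -> B `<=` X -> mu (X `&` S @^-1` B) = mu B.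

(* A Borel subset of the line is a standard Borel space.  S is only required
   to map almost every point of X into X. *)
Definition measure_preserving_system (R : realType) (X : set R)
    (mu : {measure set (measurableTypeR R) -> \bar R}) (S : R -> R) : Prop :=
  [/\ measurable X, mu X = 1%E, measurable_fun X S,
      mu.-negligible [set x | X x /\ ~ X (S x)] &
      invariant_measure_on X mu S].

Definition metrically_equivalent (R : realType)
    (X : set R) (mu : {measure set (measurableTypeR R) -> \bar R}) (S : R -> R)
    (Y : set R) (nu : {measure set (measurableTypeR R) -> \bar R}) (T : R -> R)
    : Prop :=
  [/\ measure_preserving_system X mu S,
      measure_preserving_system Y nu T &
      exists (X0 Y0 : set R) (Phi Psi : R -> R),
      [/\ [/\ measurable X0, X0 `<=` X, mu (X `\` X0) = 0%E &
              forall x, X0 x -> X0 (S x)],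
          [/\ measurable Y0, Y0 `<=` Y, nu (Y `\` Y0) = 0%E &
              forall y, Y0 y -> Y0 (T y)],
          [/\ set_bij X0 Y0 Phi, forall x, X0 x -> Psi (Phi x) = x,
              measurable_fun X0 Phi & measurable_fun Y0 Psi],
          forall B : set R, measurable B -> B `<=` Y0 ->
            mu (X0 `&` Phi @^-1` B) = nu B &
          forall x, X0 x -> Phi (S x) = T (Phi x)]].

(* The intervals are U_m = (a m, b m), m ranging over a finite or infinite set
   D of natural numbers.  Two translated intervals are disjoint modulo endpoints
   iff the translates of the open intervals are disjoint. *)
Definition countable_IET (R : realType) (T : R -> R) : Prop :=
  let I : set R := `[0, 1]%classic in
  [/\ forall x, I x -> I (T x),
      measurable_fun I T &
      exists (D : set nat) (a b d : nat -> R),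
        let U m : set R := `]a m, b m[%classic in
        let V m : set R := `]a m + d m, b m + d m[%classic in
      [/\ forall m, D m -> [/\ a m < b m, U m `<=` I & V m `<=` I],
          trivIset D U /\ trivIset D V,
          lebesgue_measure (I `\` \bigcup_(m in D) U m) = 0%E,
          lebesgue_measure (I `\` \bigcup_(m in D) V m) = 0%E &
          forall m, D m ->
            {ae lebesgue_measure, forall u : R, U m u -> T u = u + d m}]].

(* Main.v *)
(** The map [S] is injective off a null set.  Otherwise two branches of [S] have
    images that are not mutually singular, and by the Hahn decomposition there are a
    set [A] of positive measure and [e > 0] such that [S] multiplies the measure of
    every measurable subset of [A] by at least [1 + e].  A set on which [S^n] is
    injective and whose points visit [A] at least [M] times then has measure at most
    [(1 + e)^-M].  As [S^n x - x] takes only polynomially many values in [n], the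
    points visiting [A] with positive frequency would form a set of small measure.

    So [S] agrees almost everywhere with an automorphism [f] of the measure space.
    The sets [B_n] of the points [x] with [x <= f^l x] for all [l <= n] decrease and
    meet almost every orbit, and a point of all of them is almost surely periodic.
    Partition [B_n] by what the orbit does (as seen by the previous partitions and by
    the [n]-th rational cut) until it returns to [B_n], and code a point by, for each
    [n], the class of its last visit to [B_n] and the time elapsed since.  Almost
    every point has a cylinder of codes on which [f] adds a constant to each further
    digit, so that [f] preserves the lexicographic order of the codes there.

    Finally send [x] to the measure of the set of the points with a smaller code.
    This carries the measure to Lebesgue measure, cylinders to intervals, and [f] to
    a map that translates countably many intervals of full measure. *)
Require Import Defs.
From mathcomp Require Import all_boot all_order all_algebra.
From mathcomp Require Import all_classical all_reals all_analysis.
From mathcomp Require Import measurable_realfun.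
From mathcomp Require Import ring lra zify.
Set Implicit Arguments.
Unset Strict Implicit.
Unset Printing Implicit Defensive.
Import Order.TTheory GRing.Theory Num.Theory.
Import numFieldNormedType.Exports.
Local Open Scope classical_set_scope.
Local Open Scope ring_scope.

(** * Recurrence *)

(** The obvious conjugacy, sending x to the measure of [0, x), does not work: the images of two
    pieces can be interleaved while being disjoint up to a null set, and then the image of an
    interval need not be an interval even up to a null set. So the points are reordered by codes, in
    such a way that cylinders are intervals of the new order and f maps suitable cylinders onto
    cylinders.

    The codes move by constants for the following reason. If f x is outside B_n, it is outside all
    later bases, so no last visit changes from there on and every elapsed time grows by one. The
    points never outside are almost surely periodic. Once n reaches the period, B_n meets the orbit
    in a single point, the same for all later n; when f x is that point, the further classes stay
    and the elapsed times drop to 0 from a common value. The classes record the period, so that all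
    this is visible on a cylinder.

    The rational cuts make the codes separate points. Non-atomicity then makes each single code
    null, so that positions are uniformly distributed. *)

Definition preserves d (T : measurableType d) (R : realType)
    (mu : probability T R) (f : T -> T) : Prop :=
  measurable_fun setT f /\
  forall B, measurable B -> mu (f @^-1` B) = mu B.

Section preserves.
Context d (T : measurableType d) (R : realType).
Variables (mu : probability T R) (f : T -> T).
Hypothesis pf : preserves mu f.

Lemma preserves_measurable B : measurable B -> measurable (f @^-1` B).
Proof. by case: pf => mf _ mB; rewrite -[X in measurable X]setTI; exact: mf. Qed.

Lemma preserves_iter n : preserves mu (iter n f).
Proof.
elim: n => [|n [mn IH]]; first by split => //; exact: measurable_id.
case: (pf) => mf invf; split.
  by rewrite (_ : iter n.+1 f = f \o iter n f)//; exact: measurableT_comp.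
move=> B mB; rewrite (_ : _ @^-1` _ = iter n f @^-1` (f @^-1` B))//.
by rewrite IH ?invf//; exact: preserves_measurable.
Qed.

Lemma ae_preimage (P : T -> Prop) :
  (\forall x \ae mu, P x) -> \forall x \ae mu, P (f x).
Proof.
case=> A [mA A0 PA]; exists (f @^-1` A); split.
- exact: preserves_measurable.
- by case: pf => _ ->.
- by move=> x nPx; exact: PA.
Qed.

End preserves.

Section almost_everywhere.
Context d (T : measurableType d) (R : realType).
Variable mu : {measure set T -> \bar R}.
Implicit Types P Q : T -> Prop.

Lemma ae_imp P Q : (forall x, P x -> Q x) ->
  (\forall x \ae mu, P x) -> \forall x \ae mu, Q x.
Proof. by move=> PQ; apply: filterS. Qed.

Lemma ae_imp2 P1 P2 Q : (forall x, P1 x -> P2 x -> Q x) ->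
  (\forall x \ae mu, P1 x) -> (\forall x \ae mu, P2 x) ->
  \forall x \ae mu, Q x.
Proof. by move=> PQ; apply: filterS2. Qed.

Lemma ae_forall_countable (I : countType) (P : I -> T -> Prop) :
  (forall i, \forall x \ae mu, P i x) -> \forall x \ae mu, forall i, P i x.
Proof.
move=> aeP.
have : \forall x \ae mu, forall k : nat, if unpickle k is Some i then P i x else True.
  by apply: ae_foralln => k; case: unpickle => [i|]; [exact: aeP|exact: aeW].
by apply: filterS => x H i; have := H (pickle i); rewrite pickleK.
Qed.

End almost_everywhere.

Section recurrence.
Context d (T : measurableType d) (R : realType).
Variables (mu : probability T R) (f : T -> T).
Hypothesis pf : preserves mu f.

Lemma ae_orbit (P : T -> Prop) :
  (\forall x \ae mu, P x) -> \forall x \ae mu, forall n, P (iter n f x).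
Proof. by move=> aeP; apply: ae_foralln => n; exact: (ae_preimage (preserves_iter pf n)). Qed.

(** The preimages of [W] under the iterates are pairwise disjoint and equally large, and for every
    [n] the first [n] of them fit into measure 1. *)
Lemma wandering_measure0 (W : set T) : measurable W ->
  (forall x n, W x -> ~ W (iter n.+1 f x)) -> mu W = 0%E.
Proof.
move=> mW wW.
have fW : mu W \is a fin_num by exact: fin_num_measure.
have bound n : fine (mu W) *+ n <= 1.
  have mF i : measurable (iter i f @^-1` W).
    exact: (preserves_measurable (preserves_iter pf i)).
  have tF : trivIset setT (fun i : 'I_n => iter i f @^-1` W).
    apply/trivIsetP => i j _ _ ij; rewrite -subset0 => x [/= Wi Wj].
    wlog ltij : i j {ij} Wi Wj / (i < j)%N.
      move=> H; case: (ltngtP i j) => [|/H|/val_inj/eqP]; [exact: H|exact|].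
      by rewrite (negbTE ij).
    apply: (wW _ (j - i).-1 Wi).
    by rewrite prednK ?subn_gt0// -iterD subnK// ltnW.
  have eqn : mu (\big[setU/set0]_(i < n) (iter i f @^-1` W)) = (mu W *+ n)%E.
    apply: etrans (measure_bigsetU_ord mu xpredT (fun i => mF (nat_of_ord i)) tF) _.
    rewrite (eq_bigr (fun=> mu W)); first by rewrite sumr_const cardT size_enum_ord.
    by move=> i _; exact: (preserves_iter pf i).2.
  rewrite -lee_fin EFin_natmul fineK// -eqn probability_le1//.
  exact: bigsetU_measurable.
apply/eqP/negPn/negP => W0.
have W_gt0 : 0 < fine (mu W).
  by rewrite fine_gt0// lt_neqAle eq_sym W0 measure_ge0/= ltey_eq fW.
have := bound (Num.truncn (fine (mu W))^-1).+1.
rewrite leNgt => /negP; apply.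
by rewrite -mulr_natl -ltr_pdivrMr// div1r truncnS_gt.
Qed.

(* Points of [E] that never return to [E] form a wandering set. *)
Lemma poincare_recurrence (E : set T) : measurable E ->
  \forall x \ae mu, forall n, E (iter n f x) ->
    forall N, exists2 m, (N <= m)%N & E (iter m f x).
Proof.
move=> mE.
pose W := E `&` \bigcap_n (iter n.+1 f @^-1` (~` E)).
have mW : measurable W.
  apply: measurableI => //; apply: bigcapT_measurable => n.
  by apply: (preserves_measurable (preserves_iter pf _)); exact: measurableC.
have W0 : mu W = 0%E.
  by apply: wandering_measure0 => // x n [_ /(_ n I) nE] [].
have : \forall x \ae mu, ~ W x.
  by exists W; split => // x /= /contrapT.
move=> /ae_orbit; apply: filterS => x nW n En N.
apply: contrapT => H; have {}H m : (N <= m)%N -> ~ E (iter m f x).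
  by move=> Nm Em; apply: H; exists m.
(* If the visits to [E] stopped, the last one, at time [k], would be a point of [W]. *)
have [k Ek kmax] : exists2 k, E (iter k f x) & forall m, (k < m)%N -> ~ E (iter m f x).
  pose p m := `[< E (iter m f x) >].
  have bp m : p m -> (m <= N)%N.
    by move=> /asboolP Em; rewrite leqNgt; apply/negP => /ltnW/H.
  have exp : exists m, p m by exists n; apply/asboolP.
  case: (ex_maxnP exp bp) => k /asboolP Ek kmax; exists k => // m km Em.
  have /kmax : p m by apply/asboolP.
  by rewrite leqNgt km.
apply: (nW k); split => // m _ /=.
by rewrite -iterS -iterD; apply: kmax; rewrite addSn ltnS leq_addl.
Qed.

End recurrence.

(** * Essential injectivity *)

Section singular_or_comparable.
Local Open Scope ereal_scope.
Context d (T : measurableType d) (R : realType).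
Variables m1 m2 : {charge set T -> \bar R}.
Hypotheses (m1_ge0 : forall A, 0 <= m1 A) (m2_ge0 : forall A, 0 <= m2 A).

(** Take Hahn decompositions of [m2 - m1 / (k + 1)]. A positive part that is not [m1]-null serves as
    [E]. If all are [m1]-null, so is their union, and off it [m2] is at most [m1 / (k + 1)] for
    every [k], hence zero. *)
Lemma singular_or_comparable :
  (exists P, [/\ measurable P, m1 P = 0 & m2 (~` P) = 0]) \/
  (exists (E : set T) (e : R), [/\ measurable E, 0 < m1 E, (0 < e)%R &
     forall C, measurable C -> C `<=` E -> e%:E * m1 C <= m2 C]).
Proof.
pose nu k : {charge set T -> \bar R} :=
  cadd m2 (cscale (- k.+1%:R^-1) m1).
have nuE k A : nu k A = m2 A + (- k.+1%:R^-1)%:E * m1 A by [].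
have /choice[P PN] : forall k, exists P, exists N, hahn_decomposition (nu k) P N.
  by move=> k; exact: Hahn_decomposition.
have mP k : measurable (P k) by have [N [[]]] := PN k.
have le k (C D : \bar R) : C \is a fin_num -> D \is a fin_num ->
    (0 <= D + (- k.+1%:R^-1)%:E * C) = ((k.+1%:R^-1)%:E * C <= D).
  by move=> /fineK <- /fineK <-; rewrite -!EFinM -EFinD !lee_fin mulNr subr_ge0.
have [[k Pk]|P0] := pselect (exists k, m1 (P k) != 0).
  right; exists (P k), k.+1%:R^-1%R; split => //.
  - by rewrite lt_neqAle eq_sym Pk m1_ge0.
  - move=> C mC CP; have [N [[_ /(_ C mC CP) + _ _ _]]] := PN k.
    by rewrite nuE le// fin_num_measure.
left; exists (\bigcup_k P k); split.
- exact: bigcupT_measurable.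
- have P0' k : m1 (P k) = 0.
    by apply/eqP; apply: contrapT => /negP H; apply: P0; exists k.
  pose m : {measure set T -> \bar R} := measure_of_charge m1 m1_ge0.
  apply/(@measure_negligible _ _ _ m); first exact: bigcupT_measurable.
  by apply: negligible_bigcup => k; apply/negligibleP => //; exact: P0'.
set N := ~` _; have mN : measurable N.
  by apply: measurableC; exact: bigcupT_measurable.
have bound k : (fine (m2 N) <= k.+1%:R^-1 * fine (m1 N))%R.
  have [N' [_ [_ negN'] U _]] := PN k.
  have NN' : N `<=` N'.
    move=> x Nx; have : (P k `|` N') x by rewrite U.
    by case=> // Px; exfalso; apply: Nx; exists k.
  have := negN' _ mN NN'; rewrite nuE.
  rewrite -(fineK (fin_num_measure m1 _ mN)) -(fineK (fin_num_measure m2 _ mN)) /=.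
  by rewrite -!EFinM -EFinD !lee_fin mulNr subr_le0.
apply/eqP; apply: contrapT => /negP N0.
have m2N : (0 < fine (m2 N))%R.
  by rewrite fine_gt0// lt_neqAle eq_sym N0 m2_ge0 ltey_eq fin_num_measure.
have m1N : (0 <= fine (m1 N))%R by rewrite fine_ge0.
have := bound (Num.truncn (fine (m1 N) / fine (m2 N))).
rewrite leNgt => /negP; apply.
by rewrite mulrC ltr_pdivrMr// mulrC -ltr_pdivrMr// truncnS_gt.
Qed.

End singular_or_comparable.

Lemma charge_restrict_pushforward d (T : measurableType d) (R : realType)
    (mu : probability T R) (D : set T) (f : T -> T) :
  measurable D -> measurable_fun setT f ->
  exists m : {charge set T -> \bar R}, forall B, m B = mu (D `&` f @^-1` B).
Proof.
move=> mD mf.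
unshelve eexists (pushforward (crestr (charge_of_finite_measure mu) mD) f :
  {charge set T -> \bar R}); first exact: mf.
by move=> B; rewrite setIC.
Qed.

Section exponential_beats_polynomial.
Variable R : realType.

(** In [no_growth], [n] is the length of an orbit, [M] a number of visits, [a] the measure of [A]
    and [N] the number of translations. As (1 + e)^L >= e L, the power (1 + e)^((N + 1) L) is at
    least (e L)^(N + 1), which has one factor [L] more than the polynomial (K' L)^N. *)
Lemma exponential_beats_polynomial (N : nat) (a e : R) : 0 < a -> 0 < e ->
  exists n M : nat, [/\ (0 < n)%N, M%:R <= n%:R * (a / 2) &
    n.+1%:R ^+ N < a / 2 * (1 + e) ^+ M].
Proof.
move=> a0 e0.
(* [K] yields the bound on [M], [K'] is such that n + 1 <= K' L, and [L] absorbs all constants. *)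
pose K := (Num.truncn (2 / a)).+1.
have Ka : 2 <= K%:R * a by rewrite -ler_pdivrMr// ltW// truncnS_gt.
pose K' := (N.+1 * K).+1.
pose L := (Num.truncn ((K'%:R ^+ N) / (a / 2 * e ^+ N.+1))).+1.
have ae : 0 < a / 2 * e ^+ N.+1 by rewrite mulr_gt0 ?exprn_gt0 ?divr_gt0.
have L0 : 0 < L%:R :> R by rewrite ltr0n.
have La : K'%:R ^+ N < L%:R * (a / 2 * e ^+ N.+1).
  by rewrite -ltr_pdivrMr// truncnS_gt.
exists (N.+1 * L * K)%N, (N.+1 * L)%N; split => //.
- rewrite [X in X * _]natrM -(mulrA _ K%:R) ler_peMr// mulrA ler_pdivlMr// mul1r.
  exact: Ka.
- apply: (@le_lt_trans _ _ ((K'%:R * L%:R) ^+ N)).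
    rewrite lerXn2r ?nnegrE ?mulr_ge0//.
    rewrite -natrM ler_nat /K' [leqRHS]mulSn mulnAC -add1n.
    by rewrite leq_add2r.
  have -> : (1 + e) ^+ (N.+1 * L) = ((1 + e) ^+ L) ^+ N.+1.
    by rewrite -exprM mulnC.
  apply: (@lt_le_trans _ _ (a / 2 * (e * L%:R) ^+ N.+1)).
    rewrite exprMn exprMn (exprS L%:R).
    have -> : a / 2 * (e ^+ N.+1 * (L%:R * L%:R ^+ N)) =
              L%:R * (a / 2 * e ^+ N.+1) * L%:R ^+ N by ring.
    by rewrite ltr_pM2r ?exprn_gt0.
  apply: ler_wpM2l; first by rewrite ltW// divr_gt0.
  rewrite lerXn2r// ?nnegrE; first by rewrite mulr_ge0// ltW.
    by rewrite exprn_ge0// addr_ge0// ltW.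
  elim: (L) => [|k IH]; first by rewrite expr0 mulr0 ler01.
  rewrite exprS mulrDl mul1r -natr1 mulrDr mulr1.
  by rewrite lerD// ler_peMr ?(ltW e0)// exprn_ege1// lerDl ltW.
Qed.

End exponential_beats_polynomial.

Section displacements.
Variable R : realType.

Fixpoint displacements (n : nat) (cs : seq R) : seq R :=
  if cs is c :: cs' then
    [seq d + c *+ m | d <- displacements n cs', m <- iota 0 n.+1]
  else [:: 0].

Lemma size_displacements n cs : size (displacements n cs) = (n.+1 ^ size cs)%N.
Proof.
elim: cs => [|c cs IH] //; rewrite expnSr -IH -[n.+1 in RHS](size_iota 0).
exact: (size_allpairs (fun d m => d + c *+ m)).
Qed.

Lemma displacements_consP n c cs d :
  reflect (exists d' m, [/\ d' \in displacements n cs, (m <= n)%N & d = d' + c *+ m])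
          (d \in displacements n (c :: cs)).
Proof.
apply: (iffP (@allpairsPdep _ _ _ (fun d' m => d' + c *+ m) _ _ _)).
  by move=> [d' [m [Dd' im ->]]]; exists d', m; rewrite mem_iota in im.
by move=> [d' [m [Dd' im ->]]]; exists d', m; split; rewrite // mem_iota.
Qed.

Lemma displacements0 cs : 0 \in displacements 0 cs.
Proof.
elim: cs => [|c cs IH]; first by rewrite inE.
by apply/displacements_consP; exists 0, 0%N; rewrite mulr0n addr0.
Qed.

Lemma displacementsS n cs d : d \in displacements n cs -> d \in displacements n.+1 cs.
Proof.
elim: cs d => [|c cs IH] d // /displacements_consP[d' [m [Dd' im ->]]].
by apply/displacements_consP; exists d', m; split => //; [exact: IH|exact: leqW].
Qed.

Lemma displacementsD n cs c d :
  c \in cs -> d \in displacements n cs -> d + c \in displacements n.+1 cs.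
Proof.
elim: cs d => [|c0 cs IH] d //; rewrite inE => cc /displacements_consP[d' [m [Dd' im ->]]].
apply/displacements_consP; case/predU1P: cc => [->|cc].
  by exists d', m.+1; rewrite ltnS im mulrSr addrA displacementsS.
by exists (d' + c), m; rewrite IH// leqW// addrAC.
Qed.

End displacements.

Section finitely_many_translations.
Variable R : realType.
Variables (mu : probability (measurableTypeR R) R) (s : R -> R) (cs : seq R).
Hypothesis ps : preserves mu s.
Hypothesis scs : forall x, s x - x \in cs.

Lemma iter_displacement n x : iter n s x - x \in displacements n cs.
Proof.
elim: n => [|n IH]; first by rewrite subrr displacements0.
by rewrite iterS -(subrKA (iter n s x)) addrC displacementsD.
Qed.

Definition branch c : set R := [set x | s x = x + c].

Lemma measurable_displacement n d :
  @measurable _ (measurableTypeR R) [set x | iter n s x - x = d].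
Proof.
have [mn _] := preserves_iter ps n.
have m : measurable_fun [set: measurableTypeR R] (fun x => iter n s x - x : measurableTypeR R).
  by apply: measurable_funB.
rewrite (_ : [set _ | _] = (fun x => iter n s x - x) @^-1` [set d])//.
by rewrite -[X in measurable X]setTI; exact: m.
Qed.

Lemma measurable_branch c : @measurable _ (measurableTypeR R) (branch c).
Proof.
rewrite (_ : branch c = [set x | iter 1 s x - x = c]); first exact: measurable_displacement.
apply/seteqP; split => x; rewrite /branch /=; first by move=> ->; rewrite addrAC subrr add0r.
by move=> <-; rewrite addrC subrK.
Qed.

Lemma measurable_translate (C : set R) c : @measurable _ (measurableTypeR R) C ->
  @measurable _ (measurableTypeR R) [set y | C (y - c)].
Proof.
move=> mC.
have m : measurable_fun [set: measurableTypeR R] (fun y => y - c : measurableTypeR R).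
  by apply: measurable_funB; [exact: measurable_id|exact: measurable_cst].
by rewrite -[X in measurable X]setTI; exact: m.
Qed.

(** Images of Borel sets need not be Borel. Here [s] is a translation on each of finitely many
    branches, so the image is a finite union of translated pieces. *)
Lemma measurable_image (C : set R) : @measurable _ (measurableTypeR R) C ->
  @measurable _ (measurableTypeR R) (s @` C).
Proof.
move=> mC.
rewrite (_ : s @` C = \bigcup_(c in [set` cs]) [set y | (C `&` branch c) (y - c)]).
  rewrite bigcup_seq; apply: bigsetU_measurable => c _.
  apply: measurable_translate; apply: measurableI => //; exact: measurable_branch.
apply/seteqP; split => [_ [x Cx <-]|y [c cc [Cy sy]]].
  by exists (s x - x) => //=; rewrite /branch opprB addrC subrK/=; split => //; rewrite addrC subrK.
by exists (y - c) => //; rewrite sy subrK.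
Qed.

Lemma measurable_image_iter n (C : set R) : @measurable _ (measurableTypeR R) C ->
  @measurable _ (measurableTypeR R) (iter n s @` C).
Proof.
move=> mC; elim: n => [|n IH]; first by rewrite image_id.
by rewrite (_ : iter n.+1 s = s \o iter n s)// -image_comp; exact: measurable_image.
Qed.

Lemma measure_image_ge (C : set R) : @measurable _ (measurableTypeR R) C ->
  (mu C <= mu (s @` C))%E.
Proof.
move=> mC; have mI := measurable_image mC.
rewrite -(ps.2 _ mI); apply: le_measure; rewrite ?inE//.
  exact: (preserves_measurable ps).
exact: preimage_image.
Qed.

Section growth.
Variables (A : set R) (e : R).
Hypothesis mA : @measurable _ (measurableTypeR R) A.
Hypothesis e_gt0 : 0 < e.
Hypothesis growA : forall C : set R, @measurable _ (measurableTypeR R) C ->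
  C `<=` A -> (1 + e) * fine (mu C) <= fine (mu (s @` C)).

Definition visits n x := (\sum_(i < n) (iter i s x \in A))%N.

Lemma visitsS n x : visits n.+1 x = ((x \in A) + visits n (s x))%N.
Proof.
rewrite /visits big_ord_recl/=; congr addn.
by apply: eq_bigr => i _; rewrite -iterSr.
Qed.

Let fin (C : set R) : @measurable _ (measurableTypeR R) C -> mu C \is a fin_num.
Proof. by move=> mC; exact: fin_num_measure. Qed.

Let addA (C D : set R) : @measurable _ (measurableTypeR R) C ->
  @measurable _ (measurableTypeR R) D -> C `&` D = set0 ->
  fine (mu (C `|` D)) = fine (mu C) + fine (mu D).
Proof. by move=> mC mD CD; rewrite measureU// fineD// fin. Qed.

(** Split [C] into its points inside and outside [A]. The first step enlarges the former by the
    factor [1 + e] and uses up one of their visits; it does not shrink the latter. As [iter n.+1 s]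
    is injective on [C], the two final images are disjoint. *)
Lemma growth_iter n (C : set R) M : @measurable _ (measurableTypeR R) C ->
  (forall x y, C x -> C y -> iter n s x = iter n s y -> x = y) ->
  (forall x, C x -> (M <= visits n x)%N) ->
  (1 + e) ^+ M * fine (mu C) <= fine (mu (iter n s @` C)).
Proof.
elim: n C M => [|n IH] C M mC injC CM.
  have [C0|/set0P[x Cx]] := eqVneq C set0.
    by rewrite C0 image_set0 measure0 mulr0.
  have := CM _ Cx; rewrite /visits big_ord0 leqn0 => /eqP ->.
  by rewrite image_id expr0 mul1r.
have injs x y : C x -> C y -> s x = s y -> x = y.
  by move=> Cx Cy sxy; apply: injC => //; rewrite !iterSr sxy.
pose C1 := C `&` A; pose C2 := C `\` A.
have mC1 : @measurable _ (measurableTypeR R) C1 by exact: measurableI.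
have mC2 : @measurable _ (measurableTypeR R) C2 by exact: measurableD.
have C12 : C = C1 `|` C2 by rewrite setUIDK.
have C120 : C1 `&` C2 = set0 by rewrite /C1 /C2 setDE setIACA setICr setI0.
have msC1 := measurable_image mC1; have msC2 := measurable_image mC2.
have -> : iter n.+1 s @` C = (iter n s @` (s @` C1)) `|` (iter n s @` (s @` C2)).
  rewrite !image_comp -image_setU -C12; apply: eq_imagel => x _.
  by rewrite iterSr.
rewrite addA; [|exact: measurable_image_iter..|]; last first.
  rewrite -subset0 => y [[_ [x1 [Cx1 Ax1] <-] <-] [_ [x2 [Cx2 Ax2] <-]]].
  rewrite -!iterSr => /(injC _ _ Cx2 Cx1) E.
  by apply: Ax2; rewrite E.
rewrite [in mu C]C12 addA// mulrDr lerD//.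
  apply: (@le_trans _ _ ((1 + e) ^+ M.-1 * fine (mu (s @` C1)))).
    apply: (@le_trans _ _ ((1 + e) ^+ M.-1 * ((1 + e) * fine (mu C1)))).
      (* An inequality and not an identity, because [M] may be 0. *)
      rewrite mulrA -exprSr; apply: ler_wpM2r; first by rewrite fine_ge0.
      by rewrite ler_weXn2l ?leqSpred// lerDl ltW.
    apply: ler_wpM2l; last by apply: growA => // x [].
    by rewrite exprn_ge0// addr_ge0// ltW.
  apply: IH => //.
    by move=> _ _ [x [Cx _] <-] [y [Cy _] <-]; rewrite -!iterSr => /injC ->.
  move=> _ [x [Cx Ax] <-]; have := CM _ Cx; rewrite visitsS mem_set//=.
  by case: (M).
apply: (@le_trans _ _ ((1 + e) ^+ M * fine (mu (s @` C2)))).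
  apply: ler_wpM2l; first by rewrite exprn_ge0// addr_ge0// ltW.
  by rewrite fine_le// ?fin//; exact: measure_image_ge.
apply: IH => //.
  by move=> _ _ [x [Cx _] <-] [y [Cy _] <-]; rewrite -!iterSr => /injC ->.
by move=> _ [x [Cx Ax] <-]; have := CM _ Cx; rewrite visitsS memNset.
Qed.

Let mvisit i : @measurable _ (measurableTypeR R) (iter i s @^-1` A).
Proof. exact: (preserves_measurable (preserves_iter ps i)). Qed.

Let indic_visit i x : \1_(iter i s @^-1` A) x = (iter i s x \in A)%:R :> R.
Proof. by rewrite indicE; congr (_%:R); apply: asbool_equiv_eq. Qed.

Let often n M : set R := [set x | (M <= visits n x)%N].

Let measurable_often n M : @measurable _ (measurableTypeR R) (often n M).
Proof.
have m : measurable_fun [set: measurableTypeR R]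
    (fun x => \sum_(i < n) \1_(iter i s @^-1` A) x : R).
  by apply: measurable_sum => i; exact: measurable_indic.
rewrite (_ : often n M =
  (fun x => \sum_(i < n) \1_(iter i s @^-1` A) x : R) @^-1` `[M%:R, +oo[).
  by rewrite -[X in measurable X]setTI; exact: m.
apply/seteqP; split => x /=; rewrite in_itv/= andbT;
  by under eq_bigr do rewrite indic_visit; rewrite -natr_sum ler_nat.
Qed.

Let bigsetU_le (F : R -> set R) (D : seq R) (b : R) :
  (forall d, @measurable _ (measurableTypeR R) (F d)) ->
  (forall d, fine (mu (F d)) <= b) ->
  fine (mu (\big[setU/set0]_(d <- D) F d)) <= (size D)%:R * b.
Proof.
move=> mF Fb; elim: D => [|d D IH]; first by rewrite big_nil measure0 mul0r.
have mD : @measurable _ (measurableTypeR R) (\big[setU/set0]_(d <- D) F d).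
  exact: bigsetU_measurable.
rewrite big_cons -natr1 mulrDl mul1r addrC.
apply: (@le_trans _ _ (fine (mu (F d) + mu (\big[setU/set0]_(d <- D) F d)))).
  apply: fine_le; last exact: measureU2.
    by rewrite fin//; exact: measurableU.
  by rewrite fin_numD !fin.
by rewrite fineD ?fin// lerD.
Qed.

(* On the set where [iter n s x - x = d], [iter n s] is injective, and there are
   only polynomially many [d]. *)
Let often_upper n M :
  (1 + e) ^+ M * fine (mu (often n M)) <= n.+1%:R ^+ size cs.
Proof.
pose F d := often n M `&` [set x | iter n s x - x = d].
have mF d : @measurable _ (measurableTypeR R) (F d).
  by apply: measurableI => //; exact: measurable_displacement.
have eM : 0 < (1 + e) ^+ M by rewrite exprn_gt0// addr_gt0.
rewrite (_ : often n M = \big[setU/set0]_(d <- displacements n cs) F d); last first.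
  rewrite -bigcup_seq; apply/seteqP; split => [x ox|x [d _ []]//].
  by exists (iter n s x - x) => //=; exact: iter_displacement.
rewrite mulrC -ler_pdivlMr// -natrX -size_displacements.
apply: bigsetU_le => // d; rewrite -div1r ler_pdivlMr// mulrC.
apply: (@le_trans _ _ (fine (mu (iter n s @` F d)))).
  apply: growth_iter => //.
    by move=> x y [_ /= dx] [_ /= dy] sxy; move: dy; rewrite -dx sxy => /addrI/oppr_inj.
  by move=> x [].
have m := measurable_image_iter n (mF d).
by rewrite -lee_fin fineK ?fin// probability_le1.
Qed.

(** Integrate the number of visits: it is at most [M] off [often n M] and at most [n] on it, and by
    invariance its integral is [n] times the measure of [A]. *)
Let often_lower n M : n%:R * fine (mu A) <= M%:R + n%:R * fine (mu (often n M)).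
Proof.
have mo := measurable_often n M.
suff : (mu A *+ n <= (M%:R)%:E + (n%:R)%:E * mu (often n M))%E.
  rewrite -(fineK (fin mA)) -(fineK (fin mo)).
  by rewrite -EFin_natmul -EFinM -EFinD lee_fin -[X in X <= _]mulr_natl.
have : (\int[mu]_x (\sum_(i < n) (\1_(iter i s @^-1` A) x)%:E) <=
        \int[mu]_x ((M%:R)%:E + (n%:R * \1_(often n M) x)%:E))%E.
  apply: ge0_le_integral => //.
  - by move=> x _; apply: sume_ge0 => i _; rewrite lee_fin.
  - apply: emeasurable_sum => i; apply/measurable_EFinP; exact: measurable_indic.
  - apply: emeasurable_funD => //; apply/measurable_EFinP.
    by apply: measurable_funM => //; exact: measurable_indic.
  move=> x _; rewrite sumEFin -EFinD lee_fin.
  under eq_bigr do rewrite indic_visit.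
  rewrite -natr_sum indicE -/(visits n x).
  have [oM|] := boolP (x \in often n M).
    rewrite mulr1 ler_wpDl// ler_nat (leq_trans (leq_sum _ (fun i _ => leq_b1 _)))//.
    by rewrite sum1_card card_ord.
  by rewrite notin_setE /often /= mulr0 addr0 => /negP; rewrite -ltnNge ler_nat => /ltnW.
rewrite ge0_integral_sum//; last first.
  by move=> i; apply/measurable_EFinP; exact: measurable_indic.
rewrite (eq_bigr (fun=> mu A)); last first.
  by move=> i _; rewrite integral_indic// setIT; exact: (preserves_iter ps i).2.
rewrite sumr_const card_ord ge0_integralD//; last first.
  apply/measurable_EFinP.
  by apply: measurable_funM => //; exact: measurable_indic.
rewrite integral_cst// [X in (_ * X)%E](_ : _ = 1%E) ?mule1; last exact: probability_setT.
under [X in (_ + X)%E]eq_integral do rewrite EFinM.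
rewrite ge0_integralZl_EFin//; last by apply/measurable_EFinP; exact: measurable_indic.
by rewrite integral_indic// setIT.
Qed.

(** For the [n] and [M] of [exponential_beats_polynomial], [often n M] would have at least half the
    measure of [A] by [often_lower], and less than that by [often_upper]. *)
Lemma no_growth : mu A = 0%E.
Proof.
apply/eqP; apply: contrapT => /negP A0.
have a0 : 0 < fine (mu A).
  by rewrite fine_gt0// lt_neqAle eq_sym A0 measure_ge0 ltey_eq fin.
have [n [M [n0 Mn]]] := exponential_beats_polynomial (size cs) a0 e_gt0.
have n0R : 0 < n%:R :> R by rewrite ltr0n.
rewrite ltNge => /negP; apply; apply: le_trans (often_upper n M); rewrite mulrC.
apply: ler_wpM2l; first by rewrite exprn_ge0// addr_ge0// ltW.
rewrite -(ler_pM2l n0R); have := often_lower n M; move: Mn; lra.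
Qed.

End growth.

(** Otherwise there is a non-null part [A] of [branch c] such that, for each measurable [C] in [A],
    the points of [branch c'] with image in that of [C] have measure at least [e] times that of [C].
    The preimage of the image of [C] contains them and, disjointly, [C], so that [no_growth] applies
    to [A]. *)
Lemma branches_singular c c' : c != c' ->
  exists P, [/\ @measurable _ (measurableTypeR R) P,
    mu (branch c `&` s @^-1` P) = 0%E &
    mu (branch c' `&` s @^-1` (~` P)) = 0%E].
Proof.
move=> cc'.
have [ms invs] := ps.
have mb := measurable_branch.
have [m1 m1E] := charge_restrict_pushforward mu (mb c) ms.
have [m2 m2E] := charge_restrict_pushforward mu (mb c') ms.
have m_ge0 c0 B : (0 <= mu (branch c0 `&` s @^-1` B))%E by exact: measure_ge0.
have [] := @singular_or_comparable _ _ _ m1 m2 _ _.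
- by move=> B; rewrite m1E.
- by move=> B; rewrite m2E.
- by move=> [P [mP]]; rewrite m1E m2E => P0 P'0; exists P.
move=> [E [e [mE]]]; rewrite m1E => E0 e0 H; exfalso.
pose A := branch c `&` s @^-1` E.
have mA : @measurable _ (measurableTypeR R) A.
  by apply: measurableI => //; exact: (preserves_measurable ps).
suff A0 : mu A = 0%E by rewrite A0 ltxx in E0.
apply: (no_growth mA e0) => C mC CA.
have msC := measurable_image mC.
have mb' c0 : @measurable _ (measurableTypeR R) (branch c0 `&` s @^-1` (s @` C)).
  by apply: measurableI => //; exact: (preserves_measurable ps).
have fin (D : set R) : @measurable _ (measurableTypeR R) D -> mu D \is a fin_num.
  by move=> mD; exact: fin_num_measure.
have bC : branch c `&` s @^-1` (s @` C) = C.
  apply/seteqP; split => [x [bx [y Cy /= sxy]]|x Cx]; last first.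
    by split; [exact: (CA _ Cx).1|exists x].
  have := (CA _ Cy).1; rewrite /branch /= sxy bx => /addIr -> //.
have := H _ msC; rewrite m1E m2E bC => /(_ _) HC.
have {}HC : (e%:E * mu C <= mu (branch c' `&` s @^-1` (s @` C)))%E.
  by apply: HC => _ [x Cx <-]; exact: (CA _ Cx).2.
rewrite -(invs _ msC).
apply: (@le_trans _ _ (fine (mu (C `|` (branch c' `&` s @^-1` (s @` C)))))); last first.
  apply: fine_le; [by apply: fin; exact: measurableU|
    by apply: fin; exact: (preserves_measurable ps)|].
  apply: le_measure; rewrite ?inE//; [exact: measurableU|
    exact: (preserves_measurable ps)|].
  by move=> x [Cx|[]//]; exists x.
rewrite measureU//; last first.
  rewrite -subset0 => x [Cx [b'x _]].
  have := (CA _ Cx).1; rewrite /branch /= b'x => /addrI/eqP.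
  by rewrite eq_sym (negbTE cc').
rewrite fineD ?fin// mulrDl mul1r lerD2l -lee_fin EFinM !fineK ?fin//.
Qed.

(** Distinct points with the same image lie in branches of different translations. Their common
    image is in the separating set [P] of these branches or in its complement, so one of the two
    points is in the removed null set. *)
Lemma essentially_injective : exists X : set R,
  [/\ @measurable _ (measurableTypeR R) X, mu (~` X) = 0%E &
      forall x y, X x -> X y -> s x = s y -> x = y].
Proof.
have /choice[P PP] : forall cc : R * R, exists P : set R, cc.1 != cc.2 ->
    [/\ @measurable _ (measurableTypeR R) P,
    mu (branch cc.1 `&` s @^-1` P) = 0%E &
    mu (branch cc.2 `&` s @^-1` (~` P)) = 0%E].
  move=> [c c'] /=; have [cc'|] := boolP (c != c'); last by exists set0.
  by have [P ?] := branches_singular cc'; exists P.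
pose N cc := if cc.1 != cc.2 then
  (branch cc.1 `&` s @^-1` P cc) `|` (branch cc.2 `&` s @^-1` (~` P cc)) else set0.
have mN cc : @measurable _ (measurableTypeR R) (N cc).
  rewrite /N; case: ifPn => // /PP[mP _ _].
  by apply: measurableU; apply: measurableI; try exact: measurable_branch;
    apply: (preserves_measurable ps) => //; exact: measurableC.
pose S := [seq (c, c') | c <- cs, c' <- cs].
pose Y := \big[setU/set0]_(cc <- S) N cc.
have mY : @measurable _ (measurableTypeR R) Y by exact: bigsetU_measurable.
exists (~` Y); split.
- exact: measurableC.
- rewrite setCK; apply: measure_negligible => //; rewrite /Y.
  elim: (S) => [|cc S' IH]; first by rewrite big_nil; exact: negligible_set0.
  rewrite big_cons; apply: negligibleU => //; rewrite /N; case: ifPn; last first.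
    by move=> _; exact: negligible_set0.
  move=> /PP[mP P1 P2]; apply: negligibleU; apply/negligibleP => //;
    apply: measurableI; try exact: measurable_branch;
    apply: (preserves_measurable ps) => //; exact: measurableC.
move=> x y Yx Yy sxy; apply: contrapT => /eqP xy.
pose c := s x - x; pose c' := s y - y.
have cc' : c != c'.
  by apply: contra xy => /eqP; rewrite /c /c' sxy => /addrI/oppr_inj ->.
have bx : branch c x by rewrite /branch /c /= addrC subrK.
have by' : branch c' y by rewrite /branch /c' /= addrC subrK.
have Sc : (c, c') \in S by apply: allpairs_f; exact: scs.
have NY z : N (c, c') z -> Y z by move=> Nz; rewrite /Y -bigcup_seq; exists (c, c').
have [Px|nPx] := pselect (P (c, c') (s x)).
- by apply: Yx; apply: NY; rewrite /N /= cc'; left.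
- by apply: Yy; apply: NY; rewrite /N /= cc'; right; split => //=; rewrite -sxy.
Qed.

End finitely_many_translations.

(** * Invertible modifications *)

(** The inverse is required at every point, so that backward orbits come without exceptional
    sets. *)
Definition automorphism d (T : measurableType d) (R : realType)
    (mu : probability T R) (f g : T -> T) : Prop :=
  [/\ preserves mu f, preserves mu g, cancel f g & cancel g f].

Section full_measure.
Context d (T : measurableType d) (R : realType).
Variable mu : probability T R.

Lemma measureI_full (X B : set T) : measurable X -> mu (~` X) = 0%E ->
  measurable B -> mu (B `&` X) = mu B.
Proof.
move=> mX X0 mB; rewrite [RHS](measureDI mu mB mX).
rewrite (@subset_measure0 _ _ _ mu (B `\` X) (~` X)) ?add0e//.
- exact: measurableD.
- exact: measurableC.
Qed.

Lemma measureC_full (X : set T) : measurable X -> mu X = 1%E -> mu (~` X) = 0%E.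
Proof. by move=> mX X1; rewrite probability_setC// X1 subee. Qed.

Lemma ae_full_set (P : T -> Prop) : (\forall x \ae mu, P x) ->
  exists X, [/\ measurable X, mu (~` X) = 0%E & forall x, X x -> P x].
Proof.
case=> A [mA A0 PA]; exists (~` A); split; first exact: measurableC.
  by rewrite setCK.
by move=> x nAx; apply: contrapT => nPx; apply: nAx; exact: PA.
Qed.

Lemma full_set_ae (X : set T) : measurable X -> mu (~` X) = 0%E ->
  \forall x \ae mu, X x.
Proof. by move=> mX X0; exists (~` X); split => //; exact: measurableC. Qed.

Lemma measure_preserving_inverse (f g : T -> T) : preserves mu f ->
  measurable_fun setT g -> cancel f g -> preserves mu g.
Proof.
move=> pf mg fg; split => // B mB; rewrite -(pf.2 (g @^-1` B)).
  by congr (mu _); apply/seteqP; split => x /=; rewrite fg.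
by rewrite -[X in measurable X]setTI; exact: mg.
Qed.

End full_measure.

Section bijective_part.
Context d (T : measurableType d) (R : realType).
Variables (mu : probability T R) (s : T -> T) (X : set T).
Hypotheses (ps : preserves mu s)
  (s_image : forall C, measurable C -> measurable (s @` C))
  (mX : measurable X) (X_full : mu (~` X) = 0%E)
  (s_inj : forall x y, X x -> X y -> s x = s y -> x = y).

(** [A] is forward invariant and [s] is injective on it. [X0] keeps the points with backward orbits
    of every length inside [A], and [s] maps it bijectively onto itself. *)
Let A := \bigcap_n (iter n s @^-1` X).
Let X0 := \bigcap_n (iter n s @` A).

Let mA : measurable A.
Proof.
apply: bigcapT_measurable => n.
exact: (preserves_measurable (preserves_iter ps n)).
Qed.

Let As x : A x -> A (s x).
Proof. by move=> Ax n _; rewrite /= -iterSr; exact: Ax. Qed.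

Let Asn n x : A x -> A (iter n s x).
Proof. by move=> Ax; elim: n => //= n; exact: As. Qed.

Let A_inj x y : A x -> A y -> s x = s y -> x = y.
Proof. by move=> /(_ 0%N I) Xx /(_ 0%N I) Xy; exact: s_inj. Qed.

Let m_image n C : measurable C -> measurable (iter n s @` C).
Proof.
move=> mC; elim: n => [|n IH]; first by rewrite image_id.
by rewrite (_ : iter n.+1 s = s \o iter n s)// -image_comp; exact: s_image.
Qed.

Let A_full : mu (~` A) = 0%E.
Proof.
apply: measure_negligible; first exact: measurableC.
have := ae_orbit ps (full_set_ae mX X_full).
by apply: negligibleS => x /= nAx H; apply: nAx => n _; exact: H.
Qed.

Let mX0 : measurable X0.
Proof. by apply: bigcapT_measurable => n; exact: m_image. Qed.

Let X0_full : mu (~` X0) = 0%E.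
Proof.
apply: measure_negligible; first exact: measurableC.
rewrite setC_bigcap; apply: negligible_bigcup => n.
have mI := m_image n mA.
apply/negligibleP; first exact: measurableC.
apply: measureC_full => //; apply/eqP; rewrite eq_le probability_le1//=.
have <- : mu A = 1%E 
  by rewrite -[RHS](probability_setT mu) -[RHS](measureI_full mA A_full measurableT) setTI.
rewrite -((preserves_iter ps n).2 _ mI) le_measure ?inE//.
  exact: (preserves_measurable (preserves_iter ps n)).
exact: preimage_image.
Qed.

Let X0A : X0 `<=` A.
Proof. by move=> x /(_ 0%N I) [a Aa <-]. Qed.

Let X0s x : X0 x -> X0 (s x).
Proof.
move=> Xx n _; have [a Aa <-] := Xx n I.
by exists (s a); [exact: As|rewrite -iterSr].
Qed.

(** The backward orbits of the various lengths have unrelated starting points; injectivity on [A]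
    makes them all pass through the one preimage [a]. *)
Let X0_surj y : X0 y -> exists2 x, X0 x & s x = y.
Proof.
move=> Xy; have [a Aa /= ay] := Xy 1%N I; exists a => // n _.
have [b Ab] := Xy n.+1 I; rewrite iterS -ay => /(A_inj (Asn n Ab) Aa) <-.
by exists b.
Qed.

Lemma bijective_part : exists (Y : set T) (f g : T -> T),
  [/\ measurable Y, mu (~` Y) = 0%E, automorphism mu f g &
      forall x, Y x -> f x = s x].
Proof.
pose f x := if x \in X0 then s x else x.
have fX0 x : X0 x -> f x = s x by move=> Xx; rewrite /f mem_set.
have fX0' x : ~ X0 x -> f x = x by move=> Xx; rewrite /f memNset.
have surj y : exists x, f x = y.
  have [/X0_surj[x Xx sxy]|nXy] := pselect (X0 y).
    by exists x; rewrite fX0.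
  by exists y; rewrite fX0'.
have [g gf] := choice surj.
have inj : injective f.
  move=> x y.
  have [Xx|nXx] := pselect (X0 x); have [Xy|nXy] := pselect (X0 y).
  - by rewrite !fX0// => /A_inj; apply; exact: X0A.
  - by rewrite fX0// fX0'// => E; exfalso; apply: nXy; rewrite -E; exact: X0s.
  - by rewrite fX0'// fX0// => E; exfalso; apply: nXx; rewrite E; exact: X0s.
  - by rewrite !fX0'.
have fg : cancel f g by move=> x; apply: inj; rewrite gf.
have mf : measurable_fun setT f.
  move=> _ B mB; rewrite setTI.
  rewrite (_ : f @^-1` B = (X0 `&` s @^-1` B) `|` (B `\` X0)).
    apply: measurableU; last exact: measurableD.
    by apply: measurableI => //; exact: (preserves_measurable ps).
  apply/seteqP; split => x /=.
    have [Xx|nXx] := pselect (X0 x); first by rewrite fX0//; left.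
    by rewrite fX0'//; right.
  by case=> [[Xx]|[Bx nXx]]; [rewrite fX0|rewrite fX0'].
have mg : measurable_fun setT g.
  move=> _ B mB; rewrite setTI.
  rewrite (_ : g @^-1` B = (s @` (B `&` X0)) `|` (B `\` X0)).
    apply: measurableU; last exact: measurableD.
    by apply: s_image; exact: measurableI.
  apply/seteqP; split => y /=.
    move=> Bgy; have [Xg|nXg] := pselect (X0 (g y)).
      by left; exists (g y) => //; rewrite -fX0// gf.
    by right; rewrite -(gf y) (fX0' (g y)).
  case=> [[x [Bx Xx] <-]|[By nXy]]; first by rewrite -fX0// fg.
  by rewrite -(fX0' y nXy) fg.
have pf : preserves mu f.
  split => // B mB; rewrite -[RHS](ps.2 _ mB).
  rewrite -(measureI_full mX0 X0_full); last by rewrite -[X in measurable X]setTI; exact: mf.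
  rewrite -[RHS](measureI_full mX0 X0_full); last exact: (preserves_measurable ps).
  by congr (mu _); apply/seteqP; split => x [Bx Xx]; split => //; move: Bx => /=; rewrite fX0.
have pg := measure_preserving_inverse pf mg fg.
by exists X0, f, g; split; [| |split|].
Qed.

End bijective_part.

Section restriction.
Context d (T : measurableType d) (R : realType).
Variables (mu : probability T R) (f g : T -> T) (X : set T).
Hypotheses (autf : automorphism mu f g)
  (mX : measurable X) (X_full : mu (~` X) = 0%E)
  (Xf : forall x, X x -> X (f x)) (Xg : forall x, X x -> X (g x)).

Definition restriction (h : T -> T) x := if x \in X then h x else x.

Lemma restrictionE h x : X x -> restriction h x = h x.
Proof. by move=> Xx; rewrite /restriction mem_set. Qed.

Lemma restrictionN h x : ~ X x -> restriction h x = x.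
Proof. by move=> Xx; rewrite /restriction memNset. Qed.

Let cancel_restriction h k : cancel h k -> (forall x, X x -> X (h x)) ->
  cancel (restriction h) (restriction k).
Proof.
move=> hk Xh x; have [Xx|nXx] := pselect (X x).
  by rewrite restrictionE// restrictionE ?hk//; exact: Xh.
by rewrite !restrictionN// restrictionN.
Qed.

Let preserves_restriction h : preserves mu h -> preserves mu (restriction h).
Proof.
move=> ph; have mh : measurable_fun setT (restriction h).
  move=> _ B mB; rewrite setTI.
  rewrite (_ : _ @^-1` B = (X `&` h @^-1` B) `|` (B `\` X)).
    apply: measurableU; last exact: measurableD.
    by apply: measurableI => //; exact: (preserves_measurable ph).
  apply/seteqP; split => x /=.
    have [Xx|nXx] := pselect (X x); first by rewrite restrictionE//; left.
    by rewrite restrictionN//; right.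
  by case=> [[Xx]|[Bx nXx]]; [rewrite restrictionE|rewrite restrictionN].
split => // B mB; rewrite -[RHS](ph.2 _ mB).
rewrite -(measureI_full mX X_full); last by rewrite -[Y in measurable Y]setTI; exact: mh.
rewrite -[RHS](measureI_full mX X_full); last exact: (preserves_measurable ph).
by congr (mu _); apply/seteqP; split => x [Bx Xx]; split => //; move: Bx => /=;
  rewrite restrictionE.
Qed.

Lemma automorphism_restriction :
  automorphism mu (restriction f) (restriction g).
Proof.
case: autf => pf pg fg gf.
by split; [exact: preserves_restriction..|exact: cancel_restriction|
  exact: cancel_restriction].
Qed.

Lemma iter_restriction (h : T -> T) n x : (forall x, X x -> X (h x)) -> X x ->
  iter n (restriction h) x = iter n h x.
Proof.
move=> Xh Xx; have Xn m : X (iter m h x) by elim: m => //= m; exact: Xh.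
by elim: n => //= n ->; rewrite restrictionE.
Qed.

Lemma iter_restrictionN h n x : ~ X x -> iter n (restriction h) x = x.
Proof. by move=> nXx; elim: n => //= n ->; rewrite restrictionN. Qed.

End restriction.

(** * Low points *)

Section low_points.
Variable R : realType.
Implicit Types (f : R -> R) (x : R).

Definition low_points f (n : nat) : set R :=
  [set x | forall l, (l <= n)%N -> x <= iter l f x].

Definition aperiodic f x : Prop := forall p, iter p.+1 f x <> x.

Lemma low_pointsS f m n : (m <= n)%N -> low_points f n `<=` low_points f m.
Proof. by move=> mn x Bx l lm; apply: Bx; exact: leq_trans mn. Qed.

(** As [n] is at least the period, a low point is the least point of its whole orbit, so there is
    only one. *)
Lemma low_points_periodic f n p i x : (p < n)%N -> iter p.+1 f x = x ->
  low_points f n x -> low_points f n (iter i f x) -> iter i f x = x.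
Proof.
move=> pn px Bx.
have per k : iter (k * p.+1) f x = x by elim: k => // k IH; rewrite mulSn iterD IH.
have ix : iter (i %% p.+1) f x = iter i f x.
  by rewrite [in RHS](divn_eq i p.+1) addnC iterD per.
have lt : (i %% p.+1 <= p)%N by rewrite -ltnS ltn_mod.
move=> Bi; apply/le_anti/andP; split; last first.
  by rewrite -ix; apply: Bx; rewrite (leq_trans lt)// ltnW.
(* This many further steps lead from [iter i f x] back to [x]. *)
have := Bi (p.+1 - i %% p.+1)%N; rewrite -ix -iterD subnK ?px; last exact: leqW.
by apply; rewrite (leq_trans (leq_subr _ _)).
Qed.

(* If [u l1 < q <= u 1, ..., u n], a later window of length [n] with values
   [>= q] exists; the last index before it with value [< q] is a low point. *)
Lemma low_point_exists (u : nat -> R) n :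
  (forall (q : rat) i, (forall l, (0 < l <= n)%N -> ratr q <= u (i + l)%N) ->
    forall N, exists2 m, (N <= m)%N &
      forall l, (0 < l <= n)%N -> ratr q <= u (m + l)%N) ->
  exists r, forall l, (l <= n)%N -> u r <= u (r + l)%N.
Proof.
move=> rec; apply: contrapT => /forallNP H.
have {}H r : exists2 l, (l <= n)%N & u (r + l)%N < u r.
  apply: contrapT => K; apply: (H r) => l ln; rewrite leNgt; apply/negP => ul.
  by apply: K; exists l.
(* [l0] is where [u] is least on 1, ..., [n]. It is not low, so [u] drops below [u l0] at some [l1],
   and a rational [q] fits between. *)
have [l0 [l0n minl0]] : exists l0, (0 < l0 <= n)%N /\
    forall l, (0 < l <= n)%N -> u l0 <= u l.
  case: n {rec} H => [|n] H.
    by have [l'] := H 0%N; rewrite leqn0 => /eqP ->; rewrite addn0 ltxx.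
  case: (@arg_minP _ _ 'I_n.+1 ord0 predT (fun i => u i.+1) isT) => i _ imin.
  exists i.+1; split; first by rewrite ltnS ltn_ord.
  by case=> // l /= ln1; exact: (imin (Ordinal ln1)).
have [l _ ul1] := H l0; set l1 := (l0 + l)%N in ul1.
have [q /itvP qu] := rat_in_itvoo ul1.
have [m l1m Em] : exists2 m, (l1 <= m)%N &
    forall l, (0 < l <= n)%N -> ratr q <= u (m + l)%N.
  apply: (rec q 0%N) => k kn; rewrite add0n (le_trans _ (minl0 _ kn))// qu//.
have exk : exists k, (k <= m)%N && (u k < ratr q).
  by exists l1; rewrite l1m qu.
have bk k : (k <= m)%N && (u k < ratr q) -> (k <= m)%N by case/andP.
case: (ex_maxnP exk bk) => k /andP[km ukq] kmax.
have [j jn ukj] := H k.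
have j0 : (0 < j)%N by case: (j) ukj => //; rewrite addn0 ltxx.
have [kjm|mkj] := leqP (k + j) m.
  have := kmax (k + j)%N; rewrite kjm (lt_trans ukj ukq) => /(_ isT).
  by rewrite -[leqRHS]addn0 leq_add2l leqNgt j0.
have := Em (k + j - m)%N; rewrite subnKC ?(ltnW mkj)// leNgt (lt_trans ukj ukq) => /(_ _)/negP.
apply => //; rewrite subn_gt0 mkj leq_subLR (leq_trans _ (leq_add km jn))//.
Qed.

End low_points.

Section low_points_ae.
Variable R : realType.
Variable mu : probability (measurableTypeR R) R.
Implicit Types (f g : R -> R).

Let measurable_ge (q : R) : @measurable _ (measurableTypeR R) [set x | q <= x].
Proof. by rewrite (_ : [set x | _] = `[q, +oo[%classic) // set_itvcy. Qed.

Let measurable_lt (q : R) : @measurable _ (measurableTypeR R) [set x | x < q].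
Proof. by rewrite (_ : [set x | _] = `]-oo, q[%classic) // set_itvNyo. Qed.

Lemma measurable_low_points f n : preserves mu f ->
  @measurable _ (measurableTypeR R) (low_points f n).
Proof.
move=> pf.
rewrite (_ : low_points f n = \bigcap_l
    [set x | (l <= n)%N -> 0 <= iter l f x - x]); last first.
  by apply/seteqP; split => x Bx l => [_ ln|ln];
    [rewrite subr_ge0; exact: Bx|rewrite -subr_ge0; exact: Bx].
apply: bigcapT_measurable => l; have [ln|ln] := boolP (l <= n)%N; last first.
  by rewrite (_ : [set x | _] = setT)//; apply/seteqP.
have m : measurable_fun [set: measurableTypeR R] (fun x => iter l f x - x : measurableTypeR R).
  by apply: measurable_funB => //; exact: (preserves_iter pf l).1.
rewrite (_ : [set x | _] = (fun x => iter l f x - x) @^-1` [set y | 0 <= y]).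
  by rewrite -[X in measurable X]setTI; exact: m.
by apply/seteqP; split => x /=; [exact|].
Qed.

(** Poincare recurrence for the countably many sets [E q] is the recurrence that [low_point_exists]
    asks of an orbit. *)
Lemma ae_reaches_low_points f : preserves mu f ->
  \forall x \ae mu, forall n, exists r, low_points f n (iter r f x).
Proof.
move=> pf; apply: ae_foralln => n.
pose E (q : rat) := \bigcap_(l in [set l | (0 < l <= n)%N])
  (iter l f @^-1` [set x : R | ratr q <= x]).
have mE q : @measurable _ (measurableTypeR R) (E q).
  apply: bigcap_measurableType => l _.
  exact: (preserves_measurable (preserves_iter pf l)).
apply: ae_imp (ae_forall_countable (fun q => poincare_recurrence pf (mE q))) => x rec.
have [q i Ei|r Hr] := @low_point_exists R (fun i => iter i f x) n.
  move=> N; have [|m Nm Em] := rec q i _ N.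
    by move=> l ln /=; rewrite -iterD addnC; exact: Ei.
  by exists m => // l ln; rewrite addnC iterD; exact: Em.
by exists r => l ln; rewrite -iterD addnC; exact: Hr.
Qed.

(** The low points with no earlier low point on their orbit form a wandering set [H]. So the first
    low point that the forward orbit of [x] reaches has an earlier one, and this can only lie before
    [x]. *)
Lemma ae_comes_from_low_points f g : automorphism mu f g ->
  \forall x \ae mu, forall n, exists j, low_points f n (iter j g x).
Proof.
case=> pf pg fg gf; apply: ae_foralln => n.
have cgf k x : iter k g (iter k f x) = x.
  by elim: k x => // k IH x; rewrite iterSr iterS fg IH.
pose H := low_points f n `&` \bigcap_j (iter j.+1 g @^-1` (~` low_points f n)).
have mB := measurable_low_points n pf.
have mH : @measurable _ (measurableTypeR R) H.
  apply: measurableI => //; apply: bigcapT_measurable => j.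
  by apply: (preserves_measurable (preserves_iter pg _)); exact: measurableC.
have H0 : mu H = 0%E.
  apply: (wandering_measure0 pf) => // x k [Bx _] [_ /(_ k I)].
  by rewrite /preimage /= -iterS cgf.
have : \forall x \ae mu, ~ H x by exists H; split => // x /= /contrapT.
move=> /(ae_orbit pf).
apply: ae_imp2 (ae_reaches_low_points pf) => x /(_ n) [r0 Br0] nH.
pose p r := `[< low_points f n (iter r f x) >].
have exp : exists r, p r by exists r0; apply/asboolP.
case: (ex_minnP exp) => r /asboolP Br rmin.
have [j Bj] : exists j, low_points f n (iter j.+1 g (iter r f x)).
  apply: contrapT => /forallNP K; apply: (nH r); split => // j _; exact: K.
have [jr|rj] := leqP j.+1 r.
  have /rmin : p (r - j.+1)%N.
    by apply/asboolP; move: Bj; rewrite -[in iter r f x](subnKC jr) iterD cgf.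
  by rewrite leqNgt ltn_subrL (leq_trans _ jr).
exists (j.+1 - r)%N; move: Bj.
by rewrite -[in iter j.+1 g _](subnK (ltnW rj)) iterD cgf.
Qed.

(** A point that is low for all [n] bounds its forward orbit from below. If it is aperiodic, it
    returns to [Q] strictly higher, above some rational [q], and from then on the orbit stays above
    [q]. Hence it never comes back to [E q], against recurrence. *)
Lemma ae_aperiodic_not_low f g : automorphism mu f g ->
  \forall x \ae mu, aperiodic f x -> exists n, ~ low_points f n (f x).
Proof.
case=> pf pg fg gf.
pose Q := \bigcap_n low_points f n.
have mQ : @measurable _ (measurableTypeR R) Q.
  by apply: bigcapT_measurable => n; exact: measurable_low_points.
have Qle x l : Q x -> x <= iter l f x by move=> /(_ l I); exact.
pose E (q : rat) := (Q `&` [set x : R | x < ratr q]) `&`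
  \bigcup_l (iter l f @^-1` (Q `&` [set x : R | ratr q <= x])).
have mE q : @measurable _ (measurableTypeR R) (E q).
  apply: measurableI; first exact: measurableI.
  apply: bigcupT_measurable => l.
  by apply: (preserves_measurable (preserves_iter pf l)); exact: measurableI.
have ae1 := ae_forall_countable (fun q => poincare_recurrence pf (mE q)).
have ae2 := poincare_recurrence pf mQ.
(* The statement is about [f x] because [translates_outside] asks whether the next point is in the
   base. *)
suff : \forall x \ae mu, aperiodic f x -> exists n, ~ low_points f n x.
  move=> /(ae_preimage pf); apply: ae_imp => x + apx; apply => p.
  by rewrite -iterSr iterS => /(can_inj fg); exact: apx.
apply: ae_imp2 ae1 ae2 => x rE rQ apx; apply: contrapT => /forallNP K.
have Qx : Q x by move=> n _; apply: contrapT; exact: K.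
have [[//|m] _ Qm] := rQ 0%N Qx 1%N.
have xm : x < iter m.+1 f x by rewrite lt_neqAle Qle// andbT eq_sym; apply/eqP.
have [q /itvP xq] := rat_in_itvoo xm.
have Ex : E q x.
  split; first by split => //=; rewrite xq.
  by exists m.+1 => //; split => //=; rewrite xq.
have [k mk [[_ /= kq] _]] := rE q 0%N Ex m.+1.
move: kq; rewrite ltNge => /negP; apply; rewrite -(subnK mk) iterD.
by rewrite (le_trans _ (Qle _ _ Qm))// xq.
Qed.

Lemma invariant_core f g (Y : set R) : automorphism mu f g ->
  @measurable _ (measurableTypeR R) Y -> mu (~` Y) = 0%E ->
  exists X : set R, [/\ @measurable _ (measurableTypeR R) X, mu (~` X) = 0%E, X `<=` Y,
    forall x, X x -> X (f x) & forall x, X x -> X (g x)].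
Proof.
case=> pf pg fg gf mY Y0.
pose X := (\bigcap_n (iter n f @^-1` Y)) `&` (\bigcap_n (iter n g @^-1` Y)).
have mX : @measurable _ (measurableTypeR R) X.
  apply: measurableI; apply: bigcapT_measurable => n.
    exact: (preserves_measurable (preserves_iter pf n)).
  exact: (preserves_measurable (preserves_iter pg n)).
exists X; split => //.
- apply: measure_negligible; first exact: measurableC.
  have aeY := full_set_ae mY Y0.
  have : \forall x \ae mu, X x.
    apply: ae_imp2 (ae_orbit pf aeY) (ae_orbit pg aeY) => x Hf Hg.
    by split => n _; [exact: Hf|exact: Hg].
  by apply: negligibleS.
- by move=> x [/(_ 0%N I)].
- move=> x [Xf Xg]; split => n _ /=; first by rewrite -iterSr; exact: Xf.
  case: n => [|n]; first exact: (Xf 1%N I).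
  by rewrite iterSr fg; exact: Xg.
- move=> x [Xf Xg]; split => n _ /=; last by rewrite -iterSr; exact: Xg.
  case: n => [|n]; first exact: (Xg 1%N I).
  by rewrite iterSr gf; exact: Xf.
Qed.

(** Off [X] the new map is the identity, for which every point is low; so low points are met from
    every point without exception. *)
Lemma everywhere_recurrent_version f g (Y : set R) : automorphism mu f g ->
  @measurable _ (measurableTypeR R) Y -> mu (~` Y) = 0%E ->
  exists (X : set R) (f' g' : R -> R),
    [/\ [/\ @measurable _ (measurableTypeR R) X, mu (~` X) = 0%E, X `<=` Y &
          forall x, X x -> X (f' x)],
        automorphism mu f' g', forall x, X x -> f' x = f x,
        forall n x, exists r, low_points f' n (iter r f' x) &
        forall n x, exists j, low_points f' n (iter j g' x)].
Proof.
move=> autf mY Y0; have [pf _ _ _] := autf.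
have [Z [mZ Z0 ZP]] := ae_full_set (ae_imp2 (fun _ => @conj _ _)
  (ae_reaches_low_points pf) (ae_comes_from_low_points autf)).
have mYZ : @measurable _ (measurableTypeR R) (Y `&` Z) by exact: measurableI.
have YZ0 : mu (~` (Y `&` Z)) = 0%E.
  apply: measure_negligible; first exact: measurableC.
  by rewrite setCI; apply: negligibleU; apply/negligibleP => //; exact: measurableC.
have [X [mX X0 XYZ Xf Xg]] := invariant_core autf mYZ YZ0.
pose f' := restriction X f; pose g' := restriction X g.
have low n x : X x -> low_points f' n x = low_points f n x.
  move=> Xx; apply/propext; split => H l ln; first by rewrite -(iter_restriction l Xf)//; exact: H.
  by rewrite iter_restriction//; exact: H.
have lowN n x : ~ X x -> low_points f' n x.
  by move=> nXx l ln; rewrite iter_restrictionN.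
exists X, f', g'; split.
- split => //; first by move=> x /XYZ[].
  by move=> x Xx; rewrite /f' restrictionE//; exact: Xf.
- exact: automorphism_restriction.
- by move=> x Xx; rewrite /f' restrictionE.
- move=> n x; have [Xx|nXx] := pselect (X x); last by exists 0%N; exact: lowN.
  have [r Br] := (ZP _ (XYZ _ Xx).2).1 n; exists r.
  rewrite iter_restriction// low//.
  by elim: (r) => // k; exact: Xf.
- move=> n x; have [Xx|nXx] := pselect (X x); last by exists 0%N; exact: lowN.
  have [r Br] := (ZP _ (XYZ _ Xx).2).2 n; exists r.
  rewrite iter_restriction// low//.
  by elim: (r) => // k; exact: Xg.
Qed.

End low_points_ae.

(** * Coding by return times *)

Section countably_valued.
Context d (T : measurableType d).

(** For countable [C] this is measurability with respect to the discrete sigma-algebra, with no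
    structure to put on [C]. *)
Definition measurable_fibers (C : Type) (h : T -> C) : Prop :=
  forall v, measurable [set x | h x = v].

Lemma measurable_fibers_preimage (C : countType) (h : T -> C) (A : set C) :
  measurable_fibers h -> measurable (h @^-1` A).
Proof.
move=> mh.
rewrite (_ : h @^-1` A = \bigcup_k [set x | exists v, [/\ unpickle k = Some v, A v & h x = v]]).
  apply: bigcupT_measurable => k; case E : (unpickle k) => [v|]; last first.
    by rewrite (_ : [set x | _] = set0)//; apply/seteqP; split => x //= -[v []].
  have [Av|nAv] := pselect (A v).
    rewrite (_ : [set x | _] = [set x | h x = v]); first exact: mh.
    by apply/seteqP; split => [x [w [[<-]]]//|x /= hx]; exists v.
  rewrite (_ : [set x | _] = set0)//; apply/seteqP; split => x //= -[w [[vw]]].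
  by rewrite -vw.
apply/seteqP; split => [x Ax|x [k _ [v [_ Av hx]]]]; last by rewrite /preimage/= hx.
by exists (pickle (h x)) => //; exists (h x); rewrite pickleK.
Qed.

Lemma measurable_fibers_cst (C : Type) (c : C) : measurable_fibers (fun=> c).
Proof.
move=> v; have [->|cv] := pselect (c = v).
  by rewrite (_ : [set x | _] = setT)//; apply/seteqP; split.
by rewrite (_ : [set x | _] = set0)//; apply/seteqP; split.
Qed.

Lemma measurable_fibers_comp (C : Type) (h : T -> C) (k : T -> T) :
  measurable_fun setT k -> measurable_fibers h -> measurable_fibers (h \o k).
Proof. by move=> mk mh v; rewrite -[X in measurable X]setTI; exact: (mk measurableT _ (mh v)). Qed.

(** Condition on the value of [c]. This serves for iterates with a variable exponent, as in [base],
    and for lists of variable length, as in [block]. *)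
Lemma measurable_fibers_dep (C : countType) (D : Type) (c : T -> C) (h : C -> T -> D) :
  measurable_fibers c -> (forall v, measurable_fibers (h v)) ->
  measurable_fibers (fun x => h (c x) x).
Proof.
move=> mc mh w.
rewrite (_ : [set x | _] =
  \bigcup_k [set x | exists v, [/\ unpickle k = Some v, c x = v & h v x = w]]).
  apply: bigcupT_measurable => k; case E : (unpickle k) => [v|]; last first.
    by rewrite (_ : [set x | _] = set0)//; apply/seteqP; split => x //= -[v []].
  rewrite (_ : [set x | _] = [set x | c x = v] `&` [set x | h v x = w]).
    by apply: measurableI; [exact: mc|exact: mh].
  by apply/seteqP; split => x /=; [move=> [u [[->]]]|move=> [cx hx]; exists v].
apply/seteqP; split => [x /= hx|x [k _ [v [_ <- hx]]]//].
by exists (pickle (c x)) => //; exists (c x); rewrite pickleK.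
Qed.

Lemma measurable_fibers_fun (C : countType) (D : Type) (k : C -> D) (c : T -> C) :
  measurable_fibers c -> measurable_fibers (k \o c).
Proof.
move=> mc; apply: (@measurable_fibers_dep _ _ c (fun v _ => k v)) => // v.
exact: measurable_fibers_cst.
Qed.

Lemma measurable_fibers_pair (C D : countType) (c : T -> C) (h : T -> D) :
  measurable_fibers c -> measurable_fibers h ->
  measurable_fibers (fun x => (c x, h x)).
Proof.
move=> mc mh; apply: (@measurable_fibers_dep _ _ c (fun v x => (v, h x))) => // v.
exact: (measurable_fibers_fun (pair v)).
Qed.

Lemma measurable_fibers_map (C : countType) (I : Type) (h : I -> T -> C) (s : seq I) :
  (forall i, measurable_fibers (h i)) -> measurable_fibers (fun x => [seq h i x | i <- s]).
Proof.
move=> mh; elim: s => [|i s IH] /=; first exact: measurable_fibers_cst.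
apply: (@measurable_fibers_dep _ _ (h i) (fun v x => v :: [seq h j x | j <- s])) => // v.
exact: (measurable_fibers_fun (cons v)).
Qed.

Lemma measurable_fibers_mem (A : set T) : measurable A -> measurable_fibers (fun x => x \in A).
Proof.
move=> mA [].
  by rewrite (_ : [set x | _] = A)//; apply/seteqP; split => x /= => [/set_mem|/mem_set].
rewrite (_ : [set x | _] = ~` A); first exact: measurableC.
by apply/seteqP; split => x /= => [/negbT|nA]; [rewrite notin_setE|rewrite memNset].
Qed.

End countably_valued.

(* [first p] is one plus the least number satisfying [p], and [0] if there is none. *)
Definition first (p : nat -> bool) : nat :=
  if pselect (exists k, p k) is left ex then (ex_minn ex).+1 else 0%N.

Lemma firstE (p : nat -> bool) k : p k -> (forall i, (i < k)%N -> ~~ p i) -> first p = k.+1.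
Proof.
move=> pk lk; rewrite /first; case: pselect => [ex|[]]; last by exists k.
case: ex_minnP => m pm lm; congr _.+1; apply/eqP; rewrite eqn_leq lm//= leqNgt.
by apply/negP => /lk; rewrite pm.
Qed.

Lemma first_ex (p : nat -> bool) : (exists k, p k) ->
  exists k, [/\ first p = k.+1, p k & forall i, (i < k)%N -> ~~ p i].
Proof.
move=> ex; rewrite /first; case: pselect => // ex'.
case: ex_minnP => m pm lm; exists m; split => // i im.
by apply/negP => /lm; rewrite leqNgt im.
Qed.

Lemma first_eq0 (p : nat -> bool) : first p = 0%N <-> forall k, ~~ p k.
Proof.
rewrite /first; case: pselect => [ex|nex].
  by case: ex_minnP => m pm _; split => // /(_ m); rewrite pm.
by split => // _ k; apply/negP => pk; apply: nex; exists k.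
Qed.

Lemma measurable_fibers_first d (T : measurableType d) (p : T -> nat -> bool) :
  (forall k, measurable [set x | p x k]) -> measurable_fibers (fun x => first (p x)).
Proof.
move=> mp; have mnp k : measurable [set x | ~~ p x k].
  rewrite (_ : [set x | _] = ~` [set x | p x k]); first exact: measurableC.
  by apply/seteqP; split => x /= /negP.
case=> [|k].
  rewrite (_ : [set x | _] = \bigcap_k [set x | ~~ p x k]).
    exact: bigcapT_measurable.
  by apply/seteqP; split => x /= => [/first_eq0 H k _|H];
    [exact: H|apply/first_eq0 => k; exact: H].
rewrite (_ : [set x | _] = [set x | p x k] `&`
    \bigcap_(i in [set i | (i < k)%N]) [set x | ~~ p x i]).
  by apply: measurableI => //; apply: bigcap_measurableType.
apply/seteqP; split => x /= => [fk|[pk lk]]; last by rewrite (firstE pk).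
have ex : exists i, p x i.
  by apply: contrapT => /forallNP nex; move: fk; rewrite (first_eq0 _).2// => i; exact/negP/nex.
by have [l [fl pl ll]] := first_ex ex; move: fk; rewrite fl => -[<-].
Qed.

Definition agree (T : Type) (a : nat -> T -> nat) n x y : Prop :=
  forall i, (i < n)%N -> a i x = a i y.

(* [f] maps the cylinder of length [n] of [x] onto that of [f x], and shifts each
   further digit by a constant: it preserves the lexicographic order there. *)
Definition translates (T : Type) (a : nat -> T -> nat) (f : T -> T) n x : Prop :=
  (forall z, agree a n (f x) (f z) <-> agree a n x z) /\
  (forall m y, (n <= m)%N -> agree a n x y -> a m (f y) + a m x = a m y + a m (f x))%N.

Section coding.
Context d (T : measurableType d).
Variables (f g : T -> T) (B E : nat -> set T) (per : T -> nat).
Hypotheses (fg : cancel f g) (gf : cancel g f).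
Hypothesis B_decreasing : forall m n, (m <= n)%N -> B n `<=` B m.
Hypothesis to_B : forall n x, exists r, B n (iter r f x).
Hypothesis from_B : forall n x, exists j, B n (iter j g x).
Hypothesis per_f : forall x, per (f x) = per x.
(** What is kept of low points: once [n] reaches the period, an orbit meets [B n] in one point only,
    and that point is in every [B i]. The value 0 of [per] stands for aperiodic points. *)
Hypothesis per_B : forall n x k, (0 < per x <= n)%N ->
  B n x -> B n (iter k f x) -> iter k f x = x.
Hypothesis per_B_all : forall n x i, (0 < per x <= n)%N -> B n x -> B i x.

(** [age] undoes the shift by one in [first]; [return_time] keeps it, since index [k] stands for the
    time [k.+1]. *)
Definition age n x := (first (fun k => `[< B n (iter k g x) >])).-1.
Definition return_time n x := first (fun k => `[< B n (iter k.+1 f x) >]).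
Definition base n x := iter (age n x) g x.

Lemma age_spec n x : B n (base n x) /\ forall i, (i < age n x)%N -> ~ B n (iter i g x).
Proof.
have [|k [fk /asboolP Bk lk]] := @first_ex (fun k => `[< B n (iter k g x) >]).
  by have [j Bj] := from_B n x; exists j; apply/asboolP.
by rewrite /base /age fk; split => // i ik; have /asboolP := lk _ ik.
Qed.

Lemma ageE n x k : B n (iter k g x) -> (forall i, (i < k)%N -> ~ B n (iter i g x)) ->
  age n x = k.
Proof.
by move=> Bk lk; rewrite /age (@firstE _ k)//; [exact/asboolP|move=> i /lk nB; exact/asboolP].
Qed.

Lemma return_time_spec n x : exists k, [/\ return_time n x = k.+1, B n (iter k.+1 f x) &
  forall i, (i < k)%N -> ~ B n (iter i.+1 f x)].
Proof.
have [|k [fk /asboolP Bk lk]] := @first_ex (fun k => `[< B n (iter k.+1 f x) >]).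
  by have [j Bj] := to_B n (f x); exists j; apply/asboolP; rewrite iterSr.
by exists k; split => // i ik; have /asboolP := lk _ ik.
Qed.

Lemma iter_fg k x : iter k f (iter k g x) = x.
Proof. by elim: k x => // k IH x; rewrite iterSr iterS gf IH. Qed.

Lemma iter_base n x : iter (age n x) f (base n x) = x.
Proof. exact: iter_fg. Qed.

Lemma per_iter k x : per (iter k f x) = per x.
Proof. by elim: k => //= k <-; rewrite per_f. Qed.

Lemma per_base n x : per (base n x) = per x.
Proof. by rewrite -[in RHS](iter_base n x) per_iter. Qed.

Lemma age_f n x : age n (f x) = if f x \in B n then 0%N else (age n x).+1.
Proof.
have [Bx lx] := age_spec n x.
case: ifPn => [|]; rewrite ?inE ?notin_setE => Bf; first exact: ageE.
apply: ageE; first by rewrite iterSr fg.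
by case=> [|i] //; rewrite ltnS iterSr fg; exact: lx.
Qed.

Lemma base_f n x : base n (f x) = if f x \in B n then f x else base n x.
Proof. by rewrite /base age_f; case: ifPn => // _; rewrite iterSr fg. Qed.

Lemma iter_f_base n x i : (i <= age n x)%N ->
  iter i f (base n x) = iter (age n x - i) g x.
Proof. by move=> ia; rewrite /base -[in iter (age n x) g x](subnKC ia) iterD iter_fg. Qed.

Lemma age_lt_return n x : (age n x < return_time n (base n x))%N.
Proof.
have [k [-> Bk lk]] := return_time_spec n (base n x); rewrite ltnS leqNgt.
apply/negP => ka; have [_ lx] := age_spec n x.
apply: (lx (age n x - k.+1)%N); first by rewrite ltn_subrL (leq_trans _ ka).
by rewrite -iter_f_base.
Qed.

(** Whether the next step enters [B n] can thus be read off the code and the age, so it is the same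
    throughout a cylinder. *)
Lemma f_in_B n x : B n (f x) <-> return_time n (base n x) = (age n x).+1.
Proof.
have [k [E1 Bk lk]] := return_time_spec n (base n x).
have := age_lt_return n x; rewrite E1 ltnS => ak.
split => [Bf|[ka]].
  congr _.+1; apply/eqP; rewrite eqn_leq ak andbT leqNgt; apply/negP => /lk; apply.
  by rewrite iterS iter_base.
by move: Bk; rewrite ka iterS iter_base.
Qed.

(** The name of the column over [b] in the tower with base [B n]: one entry for each level below the
    return. *)
Definition block n (label : T -> nat) b : nat :=
  pickle (per b, return_time n b,
    [seq (label (iter i f b), iter i f b \in E n) | i <- iota 0 (return_time n b)]).

(** The labels used at one level are the class and the age at the level before, so that later
    classes and ages determine the earlier ones. *)
Fixpoint code n : T -> nat :=
  if n is m.+1 then fun x => block n (fun y => pickle (code m y, age m y)) (base n x)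
  else fun x => block 0 (fun=> 0%N) (base 0 x).

Lemma block_inj n label b c i : block n label b = block n label c ->
  (i < return_time n b)%N ->
  [/\ per b = per c, return_time n b = return_time n c,
      label (iter i f b) = label (iter i f c) &
      (iter i f b \in E n) = (iter i f c \in E n)].
Proof.
move=> /(pcan_inj pickleK)[pbc rbc] + ib; rewrite -rbc => ebc.
have := congr1 (fun s => nth (0%N, false) s i) ebc.
by rewrite !(nth_map 0%N) ?size_iota// nth_iota// add0n => -[].
Qed.

(** The age is less than the return time, so the block has an entry at that index, and this entry
    describes the point itself. *)
Lemma code_inj n x y : code n x = code n y -> age n x = age n y ->
  [/\ per x = per y, return_time n (base n x) = return_time n (base n y),
      (x \in E n) = (y \in E n) &
      forall m, m.+1 = n -> code m x = code m y /\ age m x = age m y].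
Proof.
move=> cxy axy; have := @age_lt_return n x.
case: n cxy axy => [|m] cxy axy lt.
  have [] := block_inj cxy lt.
  by rewrite iter_base axy iter_base !per_base.
have [] := block_inj cxy lt.
rewrite iter_base axy iter_base !per_base => -> -> lab ->; split => // _ [->].
by have := pcan_inj pickleK lab => -[].
Qed.

(** Class and age alternate, so that level [n] is complete after [n.+1.*2] digits. *)
Definition digit i x : nat := if odd i then age i./2 x else code i./2 x.

Lemma code_age_le m n x y : (m <= n)%N -> code n x = code n y -> age n x = age n y ->
  code m x = code m y /\ age m x = age m y.
Proof.
move=> /subnK <-; elim: (n - m)%N => // k IH cxy axy; apply: IH.
  by have [_ _ _ /(_ _ erefl)[]] := code_inj cxy axy.
by have [_ _ _ /(_ _ erefl)[]] := code_inj cxy axy.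
Qed.

Lemma code_age_digits n x y : code n x = code n y /\ age n x = age n y <->
  agree digit n.+1.*2 x y.
Proof.
split=> [[cxy axy] i ilt|H].
  have /code_age_le/(_ cxy axy)[ci ai] : (i./2 <= n)%N by rewrite leq_half_double -ltnS -doubleS.
  by rewrite /digit ci ai.
have := H n.*2; have := H n.*2.+1.
by rewrite /digit /= !odd_double /= uphalf_double doubleK doubleS ltnS leqnSn leqnn => -> // ->.
Qed.

Lemma code_f n x : ~ B n (f x) -> code n (f x) = code n x /\ age n (f x) = (age n x).+1.
Proof.
move=> nB; split; last by rewrite age_f memNset.
by case: n nB => [|n] nB; rewrite /= base_f memNset.
Qed.

(** On the cylinder of [x], [f] avoids [B n] by [f_in_B], hence all later bases: codes are kept and
    ages grow by one. Conversely, if [f z] is in the cylinder of [f x], its age is positive, so it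
    is not in [B n] either. *)
Lemma translates_outside n x : ~ B n (f x) -> translates digit f n.+1.*2 x.
Proof.
move=> nBx.
have step z : code n x = code n z -> age n x = age n z -> ~ B n (f z).
  move=> cxz axz /f_in_B; have [_ <- _ _] := code_inj cxz axz.
  by rewrite -axz => /f_in_B.
split => [z|m y nm /code_age_digits[cxy axy]].
  rewrite -!code_age_digits; have [cx ax] := code_f nBx; split.
    rewrite cx ax => -[cxz axz].
    have nBz : ~ B n (f z) by move=> Bz; move: axz; rewrite (age_f n z) mem_set.
    by have [cz az] := code_f nBz; move: axz; rewrite cxz cz az => -[->].
  by move=> [cxz axz]; have [cz az] := code_f (step _ cxz axz); rewrite cx ax cz az cxz axz.
have nm2 : (n <= m./2)%N by rewrite (leq_trans (leqnSn n))// geq_half_double.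
have nB z : ~ B n (f z) -> ~ B m./2 (f z).
  by move=> nBz Bz; apply: nBz; exact: B_decreasing nm2 _ Bz.
have [cx ax] := code_f (nB _ nBx); have [cy ay] := code_f (nB _ (step _ cxy axy)).
by rewrite /digit; case: ifP => _; rewrite ?cx ?cy ?ax ?ay// addSn addnS.
Qed.

Let periodic_point n x := (0 < per x <= n)%N.

Lemma periodic_base n i x : periodic_point n x -> B n (f x) -> (n <= i)%N ->
  base i x = f x.
Proof.
move=> pn Bf ni; have [Bb _] := age_spec i x.
have pb : periodic_point n (base i x) by rewrite /periodic_point per_base.
have := @per_B n (base i x) (age i x).+1 pb (B_decreasing ni Bb).
by rewrite iterS iter_base => /(_ Bf).
Qed.

Lemma periodic_age n i x : periodic_point n x -> B n (f x) -> (n <= i)%N ->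
  age i x = age n x.
Proof.
move=> pn Bf ni; have [Bi li] := age_spec i x; have [Bn ln] := age_spec n x.
apply/anti_leq/andP; split; rewrite leqNgt; apply/negP.
  move=> /li; apply; rewrite -/(base n x) (periodic_base pn Bf)//.
  by apply: (@per_B_all n) => //; rewrite per_f.
by move=> /ln; apply; exact: B_decreasing ni _ Bi.
Qed.

Lemma periodic_code n i x : periodic_point n x -> B n (f x) -> (n <= i)%N ->
  code i (f x) = code i x.
Proof.
move=> pn Bf ni; have Bi : B i (f x) by apply: (@per_B_all n) => //; rewrite per_f.
have bi : base i (f x) = f x by rewrite base_f mem_set.
by case: i ni Bi bi => [|i] ni Bi bi; rewrite /= bi (periodic_base pn Bf).
Qed.

(** At each level [i >= n] the last visit of [x] to the base was at the point [f x] itself. So [f]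
    keeps the code and resets to 0 an age that does not depend on [i]. *)
Lemma translates_periodic n x : periodic_point n x -> B n (f x) ->
  translates digit f n.+1.*2 x.
Proof.
move=> pn Bf.
have step z : code n x = code n z -> age n x = age n z ->
    periodic_point n z /\ B n (f z).
  move=> cxz axz; have [pxz rxz _ _] := code_inj cxz axz.
  by rewrite /periodic_point -pxz; split => //; apply/f_in_B; rewrite -rxz -axz; exact/f_in_B.
have age0 z i : B i (f z) -> age i (f z) = 0%N by move=> Bz; rewrite age_f mem_set.
split => [z|m y nm /code_age_digits[cxy axy]].
  rewrite -!code_age_digits; split.
    (* The age 0 of [f z] does not show the age of [z]; the latter is recovered from the return
       time, which [code n (f z)] records. *)
    rewrite age0// => -[cxz] /esym; rewrite age_f; case: ifPn => // /set_mem Bfz _.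
    have [] := code_inj cxz _; first by rewrite !age0.
    rewrite !per_f !base_f (mem_set Bf) (mem_set Bfz) => pxz rxz _ _.
    have pz : periodic_point n z by rewrite /periodic_point -pxz.
    split; first by rewrite -(periodic_code pn Bf)// cxz (periodic_code pz).
    apply/eqP; rewrite -eqSS; apply/eqP.
    rewrite -((f_in_B n x).1 Bf) -((f_in_B n z).1 Bfz).
    by rewrite !(@periodic_base n).
  move=> [cxz axz]; have [pz Bz] := step _ cxz axz.
  by rewrite !age0// (periodic_code pn Bf)// (periodic_code pz Bz).
have [py By] := step _ cxy axy.
have nm2 : (n <= m./2)%N by rewrite (leq_trans (leqnSn n))// geq_half_double.
have Bi z : periodic_point n z -> B n (f z) -> B m./2 (f z).
  by move=> pz Bz; apply: (@per_B_all n) => //; rewrite per_f.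
rewrite /digit; case: ifP => _.
  by rewrite (age0 _ _ (Bi _ py By)) (age0 _ _ (Bi _ pn Bf)) (periodic_age pn Bf)//
      (periodic_age py By)// axy addn0.
by rewrite (periodic_code pn Bf)// (periodic_code py By).
Qed.

Lemma translates_digit x : (per x = 0%N -> exists n, ~ B n (f x)) ->
  exists n, translates digit f n x.
Proof.
move=> apx; have [px|px] := posnP (per x).
  by have [n nB] := apx px; exists n.+1.*2; exact: translates_outside.
have [Bf|nBf] := pselect (B (per x) (f x)).
  by exists (per x).+1.*2; apply: translates_periodic => //; rewrite /periodic_point px leqnn.
by exists (per x).+1.*2; exact: translates_outside.
Qed.

Lemma digits_determine_E n x y : agree digit n.+1.*2 x y -> E n x -> E n y.
Proof.
move=> /code_age_digits[cxy axy] Ex; have [_ _ + _] := code_inj cxy axy.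
by rewrite (mem_set Ex) => /esym/set_mem.
Qed.

Hypotheses (mf : measurable_fun setT f) (mg : measurable_fun setT g)
  (mB : forall n, measurable (B n)) (mE : forall n, measurable (E n))
  (mper : measurable_fibers per).

Let m_iter h k : measurable_fun setT h -> measurable_fun [set: T] (iter k h).
Proof.
move=> mh; elim: k => [|k IH]; first exact: measurable_id.
by rewrite (_ : iter k.+1 h = h \o iter k h)//; exact: measurableT_comp.
Qed.

Let measurable_hit h n k : measurable_fun setT h ->
  measurable [set x | `[< B n (iter k h x) >]].
Proof.
move=> mh; rewrite (_ : [set x | _] = iter k h @^-1` B n).
  by rewrite -[X in measurable X]setTI; exact: (m_iter k mh).
by apply/seteqP; split => x /= /asboolP.
Qed.

Let measurable_age n : measurable_fibers (age n).
Proof.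
rewrite (_ : age n = predn \o fun x => first (fun k => `[< B n (iter k g x) >]))//.
apply: measurable_fibers_fun; apply: measurable_fibers_first => k.
exact: measurable_hit.
Qed.

Let measurable_return n : measurable_fibers (return_time n).
Proof. by apply: measurable_fibers_first => k; exact: measurable_hit. Qed.

Let measurable_block n (label : T -> nat) : measurable_fibers label ->
  measurable_fibers (block n label).
Proof.
move=> ml; apply: (measurable_fibers_fun pickle).
apply: (measurable_fibers_pair (measurable_fibers_pair mper (measurable_return n))).
apply: (@measurable_fibers_dep _ _ _ _ (return_time n) (fun r x =>
  [seq (label (iter i f x), iter i f x \in E n) | i <- iota 0 r])) => // r.
apply: measurable_fibers_map => i; apply: measurable_fibers_pair.
  exact: (measurable_fibers_comp (m_iter i mf)).
by apply: (measurable_fibers_comp (m_iter i mf)); exact: measurable_fibers_mem.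
Qed.

Let measurable_at_base n (C : Type) (h : T -> C) : measurable_fibers h ->
  measurable_fibers (fun x => h (base n x)).
Proof.
move=> mh; apply: (@measurable_fibers_dep _ _ _ _ (age n) (fun j x => h (iter j g x))) => // j.
exact: (measurable_fibers_comp (m_iter j mg)).
Qed.

Let measurable_code n : measurable_fibers (code n).
Proof.
elim: n => [|n IH]; apply: measurable_at_base; apply: measurable_block.
  exact: measurable_fibers_cst.
by apply: (measurable_fibers_fun pickle); exact: measurable_fibers_pair.
Qed.

Lemma measurable_digit i : measurable_fibers (digit i).
Proof. by rewrite /digit; case: (odd i). Qed.

End coding.

(** * Lexicographic order *)

Section chain.
Local Open Scope ereal_scope.
Context d (T : measurableType d) (R : realType) (mu : {measure set T -> \bar R}).

(** The unions of initial segments are themselves among the [F k]; conclude by continuity from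
    below. *)
Lemma measure_bigcup_chain_le (F : nat -> set T) (c : \bar R) : 0 <= c ->
  (forall k, measurable (F k)) -> (forall k l, F k `<=` F l \/ F l `<=` F k) ->
  (forall k, mu (F k) <= c) -> mu (\bigcup_k F k) <= c.
Proof.
move=> c0 mF chain muF.
pose U n := \big[setU/set0]_(i < n.+1) F i.
have UE n : exists k, U n = F k.
  rewrite /U; elim: n => [|n [k IH]]; first by exists 0%N; rewrite big_ord1.
  rewrite big_ord_recr/= IH.
  by case: (chain k n.+1) => [/setUidPr ->|/setUidPl ->]; [exists n.+1|exists k].
have mU n : measurable (U n) by exact: bigsetU_measurable.
have UF : \bigcup_n U n = \bigcup_k F k.
  by rewrite /U (bigcup_bigsetU_bigcup F).
rewrite -UF; have /cvg_lim <- // : mu \o U @ \oo --> mu (\bigcup_n U n).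
  apply: nondecreasing_cvg_mu => //; first exact: bigcupT_measurable.
  by move=> m n mn; apply/subsetPset; exact: subset_bigsetU (mn : (m.+1 <= n.+1)%N).
apply: lime_le; last first.
  by apply: nearW => n /=; case: (UE n) => k ->.
apply: ereal_nondecreasing_is_cvgn => m n mn /=.
by rewrite le_measure ?inE//; exact: subset_bigsetU (mn : (m.+1 <= n.+1)%N).
Qed.

End chain.

Section lexicographic.
Context d (T : measurableType d) (R : realType) (mu : probability T R).
Variable a : nat -> T -> nat.
Hypothesis ma : forall i, measurable_fibers (a i).
Hypothesis a_null : forall x, mu [set y | forall i, a i x = a i y] = 0%E.

Let cls x := [set y | forall i, a i x = a i y].

Definition cylinder n x : set T := [set y | agree a n x y].

Lemma measurable_cylinder n x : measurable (cylinder n x).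
Proof.
rewrite (_ : cylinder n x = \bigcap_(i in [set i | (i < n)%N]) [set y | a i y = a i x]).
  by apply: bigcap_measurableType => i _; exact: ma.
by apply/seteqP; split => y H i /=; [move=> lt; rewrite H|move/H].
Qed.

Let measurable_cls x : measurable (cls x).
Proof.
rewrite (_ : cls x = \bigcap_n cylinder n x).
  by apply: bigcapT_measurable => n; exact: measurable_cylinder.
by apply/seteqP; split => y H; [move=> n _ i _; exact: H|move=> i; exact: (H i.+1)].
Qed.

Lemma agree_sym n x y : agree a n x y -> agree a n y x.
Proof. by move=> H i /H. Qed.

Lemma agree_trans n x y z : agree a n x y -> agree a n y z -> agree a n x z.
Proof. by move=> H K i lt; rewrite H// K. Qed.

Lemma agreeW m n x y : (m <= n)%N -> agree a n x y -> agree a m x y.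
Proof. by move=> mn H i im; apply: H; exact: leq_trans mn. Qed.

Definition prefix_of n x : seq nat := [seq a i x | i <- iota 0 n].

Lemma prefix_of_inj n x y : prefix_of n x = prefix_of n y <-> agree a n x y.
Proof.
split=> [E i lt|H].
  have := congr1 (fun s => nth 0%N s i) E.
  by rewrite !(nth_map 0%N) ?size_iota// nth_iota.
by apply/eq_in_map => i; rewrite mem_iota add0n => /H.
Qed.

Lemma size_prefix_of n x : size (prefix_of n x) = n.
Proof. by rewrite size_map size_iota. Qed.

Lemma measurable_prefix_of n : measurable_fibers (prefix_of n).
Proof. by apply: measurable_fibers_map. Qed.

Section order.
Variable r : rel nat.
Hypotheses (r_trans : transitive r)
  (r_total : forall m n, m != n -> r m n || r n m).

(** The relation on digits is a parameter so that [pos_lt_law] can use both the order and its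
    reverse. *)
Definition lex_at n x y : Prop := agree a n x y /\ r (a n x) (a n y).
Definition lex x y : Prop := exists n, lex_at n x y.
Definition below x : set T := [set y | lex y x].

Lemma measurable_below_at n x : measurable [set y | lex_at n y x].
Proof.
rewrite (_ : [set y | _] = cylinder n x `&` a n @^-1` [set k | r k (a n x)]).
  apply: measurableI; first exact: measurable_cylinder.
  exact: measurable_fibers_preimage.
by apply/seteqP; split => y [/agree_sym ? ?]; split.
Qed.

Lemma measurable_below x : measurable (below x).
Proof.
rewrite (_ : below x = \bigcup_n [set y | lex_at n y x]).
  by apply: bigcupT_measurable => n; exact: measurable_below_at.
by apply/seteqP; split => y [n]; [exists n|move=> _ ?; exists n].
Qed.

Lemma lex_trans : forall y x z, lex x y -> lex y z -> lex x z.
Proof.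
move=> y x z [m [xy rxy]] [n [yz ryz]].
have [mn|nm|mn] := ltngtP m n.
- exists m; split; last by rewrite -(yz m mn).
  by apply: agree_trans xy _; exact: agreeW (ltnW mn) yz.
- exists n; split; last by rewrite (xy n nm).
  by apply: agree_trans _ yz; exact: agreeW (ltnW nm) xy.
- subst n; exists m; split; first exact: agree_trans xy yz.
  exact: r_trans rxy ryz.
Qed.

Lemma first_difference x y : ~ cls x y -> exists n, agree a n x y /\ a n x != a n y.
Proof.
move=> nxy; have ex : exists n, a n x != a n y.
  by apply: contrapT => /forallNP H; apply: nxy => i; apply/eqP/negPn/negP; exact: H.
by case: (ex_minnP ex) => n xy nmin; exists n; split => // i lt; apply/eqP; apply: contraLR lt;
  rewrite -leqNgt => /nmin.
Qed.

Lemma lex_total x y : [\/ lex x y, lex y x | cls x y].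
Proof.
have [|/first_difference[n [xy /r_total/orP[rxy|ryx]]]] := pselect (cls x y).
- by move=> ?; apply: Or33.
- by apply: Or31; exists n.
- by apply: Or32; exists n; split => //; exact: agree_sym.
Qed.

Lemma below_sub x y : ~ lex y x -> below x `<=` below y.
Proof.
move=> nyx z zx; have [xy|//|xy] := lex_total x y.
  exact: lex_trans zx xy.
by case: zx => n [zx rzx]; exists n; split => [i lt|]; rewrite -?xy// zx.
Qed.

(* [D] has a countable cofinal subset: choose a point of [D] in each cylinder. *)
Lemma measure_below_le (D : set T) (c : \bar R) : (0 <= c)%E ->
  measurable D -> (forall x, D x -> mu (below x) <= c)%E -> (mu D <= c)%E.
Proof.
move=> c0 mD Dc.
pose P (s : seq nat) := [set z | D z /\ prefix_of (size s) z = s].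
pose G k := if unpickle k is Some s then
  if pselect (P s !=set0) is left H then below (projT1 (cid H)) else set0 else set0.
have GE k : G k = set0 \/ exists2 z, D z & G k = below z.
  rewrite /G; case: unpickle => [s|]; last by left.
  case: pselect => [H|]; last by left.
  by case: cid => z [Dz ?] /=; right; exists z.
have mG k : measurable (G k).
  by case: (GE k) => [->//|[z _ ->]]; exact: measurable_below.
have GD : (mu (\bigcup_k G k) <= c)%E.
  apply: measure_bigcup_chain_le => //.
    move=> k l; case: (GE k) => [->|[z Dz ->]]; first by left; exact: sub0set.
    case: (GE l) => [->|[y Dy ->]]; first by right; exact: sub0set.
    have [yz|nyz] := pselect (lex y z); last by left; exact: below_sub.
    by right => u uy; exact: lex_trans uy yz.
  by move=> k; case: (GE k) => [->|[z Dz ->]]; rewrite ?measure0//; exact: Dc.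
have mUG : measurable (\bigcup_k G k) by exact: bigcupT_measurable.
(* Points of [D] that are not maximal are covered: the point chosen in the cylinder of length [i.+1]
   of [z] is above [x] as well. *)
have maxD x z : D x -> D z -> lex x z -> (\bigcup_k G k) x.
  move=> Dx Dz [i [xz rxz]]; exists (pickle (prefix_of i.+1 z)) => //.
  rewrite /G pickleK; case: pselect; last first.
    by case; exists z; split; rewrite ?size_prefix_of.
  move=> H; case: cid => y Py /=; case: Py => Dy.
  rewrite size_prefix_of => /prefix_of_inj yz.
  exists i; split; last by rewrite yz.
  by apply: agree_trans xz _; apply: agreeW (leqnSn i) _; exact: agree_sym.
(* A point [x] of [D] missed by the union is maximal in [D]; every other point of [D] is then below
   it, hence covered, or in its null class. *)
have [[x [Dx nGx]]|H] := pselect (exists x, D x /\ ~ (\bigcup_k G k) x); last first.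
  apply: le_trans GD; apply: le_measure; rewrite ?inE// => x Dx.
  by apply: contrapT => nGx; apply: H; exists x.
apply: (@le_trans _ _ (mu ((\bigcup_k G k) `|` cls x))); last first.
  by rewrite measureU0 //; exact: a_null.
apply: le_measure; rewrite ?inE//; first exact: measurableU.
move=> z Dz; case: (lex_total x z) => [xz|zx|xz]; last by right.
  by exfalso; apply: nGx; exact: maxD xz.
by left; exact: maxD zx.
Qed.

End order.

End lexicographic.

(** * Position in the lexicographic order *)

Section uniform_law.
Variable R : realType.

Lemma uniform_law_unique d (T : measurableType d) (mu : probability T R) (h : T -> R) :
  measurable_fun setT (h : T -> measurableTypeR R) -> (forall x, 0 <= h x <= 1) ->
  (forall r : R, 0 <= r <= 1 -> mu [set x | h x < r] = r%:E) ->
  forall B : set R, @measurable _ (measurableTypeR R) B ->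
    mu (h @^-1` B) = lebesgue_measure (B `&` `[0, 1]%classic).
Proof.
move=> mh h01 law.
pose I01 : set (measurableTypeR R) := `[0, 1]%classic.
have mI : measurable I01 by exact: measurable_itv.
have GE (r : R) : mu (h @^-1` `]-oo, r[%classic) = lebesgue_measure (`]-oo, r[%classic `&` I01).
  have -> : h @^-1` `]-oo, r[%classic = [set x | h x < r].
    by apply/seteqP; split => x /=; rewrite in_itv.
  have [r0|r0] := ltP r 0.
    rewrite (_ : [set x | _] = set0); last first.
      rewrite -subset0 => x /= hr; have /andP[h0 _] := h01 x.
      by move: (lt_le_trans r0 h0); rewrite ltNge ltW.
    rewrite (_ : _ `&` _ = set0) ?measure0// -subset0 => x [].
    rewrite /I01 /= !in_itv/= => xr /andP[x0 _].
    by move: (lt_trans xr r0); rewrite ltNge x0.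
  have [r1|r1] := leP r 1.
    rewrite law ?r0// (_ : _ `&` _ = `[0, r[%classic).
      by rewrite lebesgue_measure_itv/= lte_fin; case: ltgtP r0 => // [_ _|<- _];
        rewrite ?sube0// EFinN subee.
    apply/seteqP; split => x; rewrite /I01 /= !in_itv/=.
      by move=> [-> /andP[->]].
    by move=> /andP[x0 xr]; rewrite xr x0 (le_trans (ltW xr) r1).
  rewrite (_ : [set x | _] = setT); last first.
    apply/seteqP; split => // x _ /=; have /andP[_ h1] := h01 x.
    exact: le_lt_trans h1 r1.
  rewrite probability_setT (_ : _ `&` _ = `[0, 1]%classic).
    by rewrite lebesgue_measure_itv/= lte_fin ltr01 sube0.
  apply/seteqP; split => x; rewrite /I01 /= !in_itv/=; first by case.
  by move=> /[dup] /andP[_ x1] ->; rewrite (le_lt_trans x1 r1).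
have [m1 m1E] : exists m : {measure set (measurableTypeR R) -> \bar R},
    forall B, m B = mu (h @^-1` B).
  unshelve eexists (pushforward mu (h : T -> measurableTypeR R) :
    {measure set (measurableTypeR R) -> \bar R}); first exact: mh.
  by [].
pose m2 : {measure set (measurableTypeR R) -> \bar R} := mrestr lebesgue_measure mI.
move=> B mB; rewrite -m1E -[RHS]/(m2 B).
have := @measure_unique _ R (measurableTypeR R) (@RGenInftyO.G R)
  (fun n => `]-oo, n%:R[%classic) (RGenInftyO.measurableE R).
move=> /(_ _ _ _ m1 m2).
apply => //.
- move=> _ _ [x ->] [y ->]; exists (Num.min x y).
  by apply/seteqP; split => z /=; rewrite !in_itv/= lt_min => /andP.
- by move=> n; exists n%:R.
- apply/seteqP; split => // x _; exists (Num.truncn `|x|).+1 => //=.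
  by rewrite in_itv/= (le_lt_trans (ler_norm x))// truncnS_gt.
- by move=> _ [r ->]; rewrite m1E GE.
- move=> n; rewrite m1E; apply: (@le_lt_trans _ _ 1%E); last exact: ltry.
  apply: probability_le1; rewrite -[X in measurable X]setTI; exact: mh.
Qed.

End uniform_law.

Section position.
Context d (T : measurableType d) (R : realType) (mu : probability T R).
Variable a : nat -> T -> nat.
Hypothesis ma : forall i, measurable_fibers (a i).
Hypothesis a_null : forall x, mu [set y | forall i, a i x = a i y] = 0%E.

Local Notation P A := (fine (mu A)).
Local Notation cylinder := (cylinder a).
Local Notation lower := (below a ltn).

Let ltn_total m n : m != n -> ltn m n || ltn n m.
Proof. by rewrite neq_ltn. Qed.

Let mC := measurable_cylinder ma.
Let mb := measurable_below ma ltn.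

Let fin (A : set T) : measurable A -> mu A \is a fin_num.
Proof. by move=> mA; exact: fin_num_measure. Qed.

Let P_le (A B : set T) : measurable A -> measurable B -> A `<=` B -> P A <= P B.
Proof. by move=> mA mB AB; rewrite fine_le ?fin// le_measure ?inE. Qed.

Let P_U (A B : set T) : measurable A -> measurable B -> A `&` B = set0 ->
  P (A `|` B) = P A + P B.
Proof. by move=> mA mB AB; rewrite measureU// fineD ?fin. Qed.

Definition pos x : R := P (lower x).

Let before n x := [set y | exists2 i, (i < n)%N & lex_at a ltn i y x].

(** This is the measure of what precedes the whole cylinder, so the cylinder occupies the positions
    from [lo n x] to [hi n x]. *)
Definition lo n x : R := P (before n x).

Definition hi n x : R := lo n x + P (cylinder n x).

Let measurable_before n x : measurable (before n x).
Proof.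
rewrite (_ : before n x = \bigcup_(i in [set i | (i < n)%N]) [set y | lex_at a ltn i y x]).
  by apply: bigcup_measurable => i _; exact: measurable_below_at.
by apply/seteqP; split => y [i]; exists i.
Qed.

Let cylinder_before n x : cylinder n x `&` before n x = set0.
Proof.
rewrite -subset0 => y [xy [i lt [_ /=]]].
by rewrite (xy _ lt) ltnn.
Qed.

Lemma agree_cylinder n x y : agree a n x y -> cylinder n x = cylinder n y.
Proof.
move=> xy; apply/seteqP; split => z; last exact: agree_trans.
by apply: agree_trans; exact: agree_sym.
Qed.

Lemma agree_lo n x y : agree a n x y -> lo n x = lo n y.
Proof.
suff H x' y' : agree a n x' y' -> before n x' `<=` before n y'.
  move=> xy; congr (P _); apply/seteqP; split; apply: H => //; exact: agree_sym.
move=> xy z [i lt [zx azx]]; exists i => //; split; last by rewrite -(xy _ lt).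
by apply: agree_trans zx _; exact: agreeW (ltnW lt) xy.
Qed.

Lemma agree_hi n x y : agree a n x y -> hi n x = hi n y.
Proof. by move=> xy; rewrite /hi (agree_lo xy) (agree_cylinder xy). Qed.

Lemma posE n x : pos x = lo n x + P (cylinder n x `&` lower x).
Proof.
rewrite /pos /lo -P_U//; last first.
- rewrite -subset0 => y [yb [yc _]].
  by have : (cylinder n x `&` before n x) y by []; rewrite cylinder_before.
- exact: measurableI.
congr (P _); apply/seteqP; split => [y [i [yx ayx]]|y [[i _ yx]|[]//]]; last by exists i.
have [lt|ni] := ltnP i n; first by left; exists i.
right; split; last by exists i.
by apply: agree_sym; exact: agreeW ni yx.
Qed.

Lemma lo_ge0 n x : 0 <= lo n x.
Proof. by rewrite fine_ge0. Qed.

Lemma hi_le1 n x : hi n x <= 1.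
Proof.
rewrite /hi /lo -P_U//; last by rewrite setIC cylinder_before.
by rewrite -lee_fin fineK ?fin ?probability_le1//; exact: measurableU.
Qed.

Lemma lo_pos_hi n x : lo n x <= pos x <= hi n x.
Proof.
rewrite (posE n) lerDl fine_ge0//= lerD2l P_le//; exact: measurableI.
Qed.

Lemma pos01 x : 0 <= pos x <= 1.
Proof.
have /andP[h0 h1] := lo_pos_hi 0 x.
by rewrite (le_trans (lo_ge0 _ _) h0) (le_trans h1 (hi_le1 _ _)).
Qed.

Lemma disagree n x y : ~ agree a n x y ->
  exists i, [/\ (i < n)%N, agree a i x y & a i x != a i y].
Proof.
move=> nxy; have ex : exists i, (i < n)%N && (a i x != a i y).
  apply: contrapT => /forallNP H; apply: nxy => i lt; apply/eqP/negPn/negP => axy.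
  by apply: (H i); rewrite lt.
case: (ex_minnP ex) => i /andP[lt axy] imin; exists i; split => // j ji.
apply/eqP/negPn/negP => jxy; have := imin j; rewrite jxy (ltn_trans ji lt) => /(_ isT).
by rewrite leqNgt ji.
Qed.

(** A point outside the cylinder of [y] first differs from [y] at some digit [i < n]. It comes after
    the whole cylinder or before it, so its position is at least [hi n y] or at most [lo n y]. *)
Lemma pos_between n x y : lo n y < pos x < hi n y -> agree a n y x.
Proof.
move=> /andP[lox hix]; apply: contrapT => nyx.
have {nyx}[i [lt yx]] := disagree nyx; rewrite neq_ltn => /orP[ayx|axy].
  move: hix; rewrite ltNge => /negP; apply.
  rewrite /hi /lo -P_U//; last by rewrite setIC cylinder_before.
  apply: P_le => //; first exact: measurableU.
  move=> z [[k kn [zy azy]]|zy]; last first.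
    exists i; split; last by rewrite -(zy _ lt).
    by apply: agree_trans yx; apply: agree_sym; exact: agreeW (ltnW lt) zy.
  have [ki|ik|ki] := ltngtP k i.
  - exists k; split; last by rewrite -(yx _ ki).
    by apply: agree_trans zy _; exact: agreeW (ltnW ki) yx.
  - exists i; split; last by rewrite (zy _ ik).
    by apply: agree_trans yx; exact: agreeW (ltnW ik) zy.
  - subst k; exists i; split; last exact: ltn_trans azy ayx.
    exact: agree_trans zy yx.
move: lox; rewrite ltNge => /negP; apply.
apply: P_le => // z [k [zx azx]]; have xy := agree_sym yx.
have [ki|ik|ki] := ltngtP k i.
- exists k; first exact: ltn_trans ki lt.
  split; last by rewrite -(xy _ ki).
  by apply: agree_trans zx _; exact: agreeW (ltnW ki) xy.
- exists i => //; split; last by rewrite (zx _ ik).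
  by apply: agree_trans xy; exact: agreeW (ltnW ik) zx.
- subst k; exists i => //; split; last exact: ltn_trans azx axy.
  exact: agree_trans zx xy.
Qed.

Lemma measurable_cylindrical (C : Type) n (h : T -> C) (A : set C) :
  (forall x y, agree a n x y -> h x = h y) -> measurable (h @^-1` A).
Proof.
move=> hE; rewrite (_ : _ @^-1` _ = prefix_of a n @^-1`
    [set s | exists2 x, prefix_of a n x = s & A (h x)]).
  by apply: measurable_fibers_preimage; exact: measurable_prefix_of.
apply/seteqP; split => x /=; first by move=> Ax; exists x.
by move=> [y /prefix_of_inj yx Ay]; rewrite /preimage /= -(hE _ _ yx).
Qed.

(** [pos] is the limit of the functions [lo n], each constant on the countably many cylinders of
    length [n]. *)
Lemma measurable_pos : measurable_fun [set: T] (pos : T -> measurableTypeR R).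
Proof.
apply: (@measurable_fun_cvg _ _ _ _ (fun n => lo n)).
  move=> n _ B _; rewrite setTI.
  by apply: (@measurable_cylindrical _ n) => x y; exact: agree_lo.
move=> x _; apply: fine_cvg; rewrite fineK ?fin//.
have -> : lower x = \bigcup_n before n x.
  apply/seteqP; split => y; first by move=> [i yx]; exists i.+1 => //; exists i.
  by move=> [n _ [i _ yx]]; exists i.
apply: nondecreasing_cvg_mu => //; first exact: bigcupT_measurable.
move=> m n mn; apply/subsetPset => y [i lt yx]; exists i => //; exact: leq_trans mn.
Qed.

(** The upper bound is [measure_below_le] for the set where [pos x < r]. The lower bound is the same
    lemma for the complement and the reversed order, as the points above [x] have measure at most
    [1 - pos x]. *)
Lemma pos_lt_law (r : R) : 0 <= r <= 1 -> mu [set x | pos x < r] = r%:E.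
Proof.
move=> /andP[r0 r1].
have mlt : measurable [set x : T | pos x < r].
  rewrite (_ : [set x : T | _] = pos @^-1` `]-oo, r[); last first.
    by apply/seteqP; split => x /=; rewrite in_itv.
  rewrite -[X in measurable X]setTI; exact: measurable_pos.
have mge : measurable [set x : T | r <= pos x].
  rewrite (_ : [set x | _] = ~` [set x : T | pos x < r]); first exact: measurableC.
  by apply/seteqP; split => x /=; rewrite leNgt => /negP.
apply/eqP; rewrite eq_le; apply/andP; split.
  apply: (@measure_below_le _ _ _ mu a ma a_null ltn ltn_trans ltn_total) => //.
  by move=> x /= /ltW; rewrite -lee_fin /pos fineK ?fin.
have gtn_total m n : m != n -> gtn m n || gtn n m by rewrite neq_ltn orbC.
have gtn_trans : transitive gtn by move=> y x z /= xy yz; exact: ltn_trans yz xy.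
have above x : (mu (below a gtn x) <= (1 - pos x)%:E)%E.
  have mg := measurable_below ma gtn x.
  rewrite EFinB /pos fineK ?fin// -probability_setC// le_measure ?inE//.
    exact: measurableC.
  move=> y [n [yx axy]] [m [yx' ayx]].
  have [mn|nm|mn] := ltngtP m n.
  - by move: ayx => /=; rewrite (yx _ mn) ltnn.
  - by move: axy => /=; rewrite (yx' _ nm) ltnn.
  - by subst m; move: axy ayx => /= /ltnW; rewrite leqNgt => /negP.
have : (mu [set x : T | (r <= pos x)%R] <= (1 - r)%:E)%E.
  apply: (@measure_below_le _ _ _ mu a ma a_null gtn gtn_trans gtn_total) => //.
    by rewrite lee_fin subr_ge0.
  by move=> x /= rx; apply: le_trans (above x) _; rewrite lee_fin lerD2l lerN2.
rewrite (_ : [set x | _] = ~` [set x : T | pos x < r]); last first.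
  by apply/seteqP; split => x /=; rewrite leNgt => /negP.
rewrite probability_setC// -(fineK (fin mlt)) -EFinB lee_fin lerD2l lerN2 => rP.
by rewrite -(fineK (fin mlt)) lee_fin.
Qed.

Lemma pos_law (B : set R) : @measurable _ (measurableTypeR R) B ->
  mu (pos @^-1` B) = lebesgue_measure (B `&` `[0, 1]%classic).
Proof. by apply: uniform_law_unique; [exact: measurable_pos|exact: pos01|exact: pos_lt_law]. Qed.

Let pos_fiber_null (v : R) : mu.-negligible [set x | pos x = v].
Proof.
have mv : @measurable _ (measurableTypeR R) [set v] by [].
apply/negligibleP; first by rewrite -[X in measurable X]setTI;
  exact: (measurable_pos measurableT mv).
apply: etrans (pos_law mv) _; apply: (subset_measure0 _ _ (@subIsetl _ _ _)) => //.
  exact: measurableI.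
exact: lebesgue_measure_set1.
Qed.

(** [e] has countably many values, one for each prefix, and [pos] takes any given value on a null
    set only. *)
Let pos_endpoint_null n (e : T -> R) : (forall x y, agree a n x y -> e x = e y) ->
  mu.-negligible [set x | pos x = e x].
Proof.
move=> eE.
pose F k := [set x | exists s, unpickle k = Some s /\ prefix_of a n x = s /\ pos x = e x].
have FU : [set x | pos x = e x] `<=` \bigcup_k F k.
  by move=> x /= px; exists (pickle (prefix_of a n x)) => //;
    exists (prefix_of a n x); rewrite pickleK.
apply: (negligibleS FU); apply: negligible_bigcup => k; rewrite /F.
case E : (unpickle k) => [s|]; last first.
  by apply: negligibleS (negligible_set0 mu); move=> x [s []].
have [[x0 s0]|nx] := pselect (exists x0, prefix_of a n x0 = s); last first.
  by apply: negligibleS (negligible_set0 mu); move=> x [t [[<-] [tx _]]]; apply: nx; exists x.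
apply: negligibleS (pos_fiber_null (e x0)); move=> x [t [[<-] [tx pe]]]; rewrite /= pe.
by apply: eE; apply/prefix_of_inj; rewrite tx s0.
Qed.

Lemma ae_interior : \forall x \ae mu, forall n, lo n x < pos x < hi n x.
Proof.
apply: ae_foralln => n.
have := negligibleU (@pos_endpoint_null n _ (@agree_lo n)) (@pos_endpoint_null n _ (@agree_hi n)).
apply: negligibleS => x /= /negP; have /andP[] := lo_pos_hi n x.
rewrite le_eqVlt => /predU1P[->|->]; first by left.
by rewrite le_eqVlt => /predU1P[->|->//]; right.
Qed.

Section translation.
Variable f : T -> T.
Hypothesis pf : preserves mu f.

Lemma translates_agree n x y : translates a f n x -> agree a n x y -> translates a f n y.
Proof.
move=> [Ht Hs] xy; have fxy := (Ht y).2 xy; split=> [z|m z nm yz].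
  split=> [fyz|yz]; last by apply: agree_trans (agree_sym fxy) _;
    apply/Ht; exact: agree_trans xy yz.
  by apply: agree_trans (agree_sym xy) _; apply/Ht; exact: agree_trans fxy fyz.
have := Hs m y nm xy; have := Hs m z nm (agree_trans xy yz); lia.
Qed.

Lemma cylinder_preimage n x : translates a f n x ->
  f @^-1` (cylinder n (f x)) = cylinder n x.
Proof. by move=> [Ht _]; apply/seteqP; split => z /Ht. Qed.

(** Beyond [n] the digits of [x] and [y] are shifted by the same amounts, so their first difference
    keeps its place and its sign. *)
Lemma lex_translates n x y : translates a f n x -> agree a n x y ->
  lex a ltn (f y) (f x) <-> lex a ltn y x.
Proof.
move=> [Ht Hs] xy.
have shift m : (n <= m)%N -> agree a m (f y) (f x) <-> agree a m y x.
  move=> nm; split => H i im; have [lt|ni] := ltnP i n.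
  - by rewrite (xy _ lt).
  - by have := Hs i y ni xy; rewrite (H i im); lia.
  - by rewrite ((Ht y).2 xy i lt).
  - by have := Hs i y ni xy; rewrite (H i im); lia.
have ge z w (i : nat) : agree a n w z -> (a i z < a i w)%N -> (n <= i)%N.
  by move=> wz azw; case: leqP => // im; move: azw; rewrite (wz i im) ltnn.
split=> -[m [yx /= ayx]]; exists m.
  have nm := ge _ _ _ ((Ht y).2 xy) ayx.
  by split; [apply/shift|have := Hs m y nm xy; move: ayx => /=; lia].
have nm := ge _ _ _ xy ayx.
by split; [apply/shift|have := Hs m y nm xy; move: ayx => /=; lia].
Qed.

(** Above the lower end of its cylinder, a point is as high as the measure of the smaller points in
    the cylinder. This is preserved, since [f] respects the order and the measure there. *)
Lemma pos_translates n x y : translates a f n x -> agree a n x y ->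
  pos (f y) = pos y + (lo n (f x) - lo n x).
Proof.
move=> tx xy; have ty := translates_agree tx xy.
have -> : pos (f y) = lo n (f x) + P (cylinder n (f y) `&` lower (f y)).
  by rewrite (posE n) (agree_lo ((tx.1 y).2 xy)).
have -> : pos y = lo n x + P (cylinder n y `&` lower y) by rewrite (posE n) (agree_lo xy).
rewrite -(pf.2 (cylinder n (f y) `&` lower (f y))); last exact: measurableI.
rewrite preimage_setI (cylinder_preimage ty).
rewrite (_ : _ `&` _ = cylinder n y `&` lower y); first by ring.
by apply/seteqP; split => z [yz zy]; split => //;
  [exact: (lex_translates ty yz).1 zy|exact: (lex_translates ty yz).2 zy].
Qed.

Lemma hi_translates n x : translates a f n x ->
  hi n (f x) = hi n x + (lo n (f x) - lo n x).
Proof.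
by move=> tx; rewrite /hi -(pf.2 _ (mC n (f x))) (cylinder_preimage tx); ring.
Qed.

End translation.

End position.

(** * The countable interval exchange *)

Definition rational_seq (R : realType) (k : nat) : R := ratr (odflt 0 (unpickle k)).

Lemma rational_seq_dense (R : realType) (x y : R) : x < y ->
  exists k, x < rational_seq R k < y.
Proof.
move=> /rat_in_itvoo[q]; rewrite in_itv => xqy; exists (pickle q).
by rewrite /rational_seq pickleK.
Qed.

Lemma digits_separate (R : realType) (mu : probability (measurableTypeR R) R)
    (a : nat -> R -> nat) :
  (forall k, exists n, forall x y, agree a n x y ->
    x < rational_seq R k -> y < rational_seq R k) ->
  (forall x, mu [set x] = 0%E) ->
  forall x, mu [set y | forall i, a i x = a i y] = 0%E.
Proof.
move=> bits mu_points x.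
rewrite (_ : [set y | _] = [set x])//; apply/seteqP; split => [y /= xy|y ->//].
apply/eqP; rewrite eq_le !leNgt; apply/andP; split; apply/negP =>
  /rational_seq_dense[k /andP[lt1 lt2]].
  have [n det] := bits k; have := det x y (fun i _ => xy i) lt1.
  by rewrite ltNge (ltW lt2).
have [n det] := bits k; have := det y x (fun i _ => esym (xy i)) lt1.
by rewrite ltNge (ltW lt2).
Qed.

Section model.
Variable R : realType.
Variables (mu : probability (measurableTypeR R) R) (f g : R -> R) (a : nat -> R -> nat).
Local Notation mset := (@measurable _ (measurableTypeR R)).
Local Notation q := (rational_seq R).
Local Notation pos := (pos mu a).
Local Notation lo := (lo mu a).
Local Notation hi := (hi mu a).
Local Notation leb := (@lebesgue_measure R).
Local Notation I01 := (`[0, 1]%classic : set R).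
Hypotheses (autf : automorphism mu f g)
  (ma : forall i, @measurable_fibers _ (measurableTypeR R) _ (a i))
  (bits : forall k, exists n, forall x y, agree a n x y -> x < q k -> y < q k)
  (mu_points : forall x, mu [set x] = 0%E)
  (ae_translates : \forall x \ae mu, exists n, translates a f n x).

Let pf : preserves mu f. Proof. by case: autf. Qed.
Let pg : preserves mu g. Proof. by case: autf. Qed.
Let fg : cancel f g. Proof. by case: autf. Qed.
Let gf : cancel g f. Proof. by case: autf. Qed.

Let a_null := digits_separate bits mu_points.

Let mpos : measurable_fun [set: measurableTypeR R] (pos : _ -> measurableTypeR R).
Proof. exact: measurable_pos. Qed.

Let mpre (B : set R) : mset B -> mset (pos @^-1` B).
Proof. by move=> mB; rewrite -[X in measurable X]setTI; exact: mpos. Qed.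

Let law (B : set R) : mset B -> mu (pos @^-1` B) = leb (B `&` I01).
Proof. exact: pos_law. Qed.

Let interior x := forall n, lo n x < pos x < hi n x.

Let ae_int : \forall x \ae mu, interior x.
Proof. exact: ae_interior. Qed.

(* [pos] is inverted through the countably many open sets [A k]: for almost every [x],
   [A k] contains [pos x] iff [x < q k]. *)
Let level k := projT1 (cid (bits k)).
Let A k : set R := [set v | exists y, y < q k /\ lo (level k) y < v < hi (level k) y].

Let open_A k : open (A k).
Proof.
rewrite (_ : A k = \bigcup_(y in [set y | y < q k]) `]lo (level k) y, hi (level k) y[%classic).
  by apply: bigcup_open => y _; exact: interval_open.
by apply/seteqP; split => v [y];
  [move=> [yq yv]; exists y => //=; rewrite in_itv|rewrite /= in_itv => yq yv; exists y].
Qed.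

Let A_pos k x : interior x -> A k (pos x) <-> x < q k.
Proof.
move=> ix; split => [[y [yq /pos_between yx]]|xq]; last by exists x.
by apply: (projT2 (cid (bits k)) y x) => //; exact: yx.
Qed.

(** Almost surely the value at [pos x] is [q k] if [x < q k] and 1 otherwise, so the infimum over
    [k] is [x] for [x] in [0, 1). The maximum with 0 bounds the values below, and the indicator
    gives measurability. *)
Let step k (v : R) : R := 1 + (Num.max 0 (q k) - 1) * \1_(A k) v.
Definition pos_inverse (v : R) : R := infs (step ^~ v) 0.

Let step_ge0 k v : 0 <= step k v.
Proof.
rewrite /step indicE; case: (v \in A k) => /=; last by rewrite mulr0 addr0.
by rewrite mulr1 addrC subrK le_max lexx.
Qed.

Let measurable_pos_inverse :
  measurable_fun [set: measurableTypeR R] (pos_inverse : _ -> measurableTypeR R).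
Proof.
apply: (@measurable_fun_infs _ (measurableTypeR R)) => [v _|k].
  by exists 0 => _ [k _ <-]; exact: step_ge0.
apply: measurable_funD; first exact: measurable_cst.
apply: measurable_funM; first exact: measurable_cst.
by apply: measurable_indic; exact: open_measurable.
Qed.

Let pos_inverseK x : interior x -> 0 <= x < 1 -> pos_inverse (pos x) = x.
Proof.
move=> ix /andP[x0 x1].
have stepE k : step k (pos x) = if x < q k then q k else 1.
  rewrite /step indicE; case: ifPn => xq.
    have -> : (pos x \in A k) = true by apply/mem_set; apply/(A_pos k ix).
    by rewrite mulr1 addrC subrK; apply: max_r; rewrite ltW// (le_lt_trans x0).
  have -> : (pos x \in A k) = false.
    by apply/memNset => /(A_pos k ix); rewrite (negbTE xq).
  by rewrite mulr0 addr0.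
have lb : lbound (sdrop (step ^~ (pos x)) 0) x.
  move=> _ [k _ <-]; rewrite stepE; case: ifP => [/ltW//|_]; exact: ltW.
have ne : sdrop (step ^~ (pos x)) 0 !=set0 by exists (step 0 (pos x)), 0%N.
apply/eqP; rewrite eq_le; apply/andP; split; last exact: lb_le_inf.
rewrite leNgt; apply/negP =>
  /rational_seq_dense[k /andP[xq]].
rewrite ltNge => /negP; apply; apply: ge_inf; first by exists x.
by exists k => //; rewrite stepE xq.
Qed.

Section invariant_set.
Variable X : set R.
Hypotheses (mX : mset X) (X_full : mu (~` X) = 0%E)
  (X_f : forall x, X x -> X (f x))
  (X_interior : forall x, X x -> interior x) (X01 : forall x, X x -> 0 <= x < 1).

(** The image of [X] under [pos], described by preimages so that it is seen to be Borel. *)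
Let Y : set R := I01 `&` (pos_inverse @^-1` X `&` [set v | pos (pos_inverse v) = v]).
Definition transported (v : R) : R := if v \in Y then pos (f (pos_inverse v)) else 0.
Local Notation T := transported.

Let mY : mset Y.
Proof.
apply: measurableI; first exact: measurable_itv.
apply: measurableI; first by rewrite -[Z in measurable Z]setTI; exact: measurable_pos_inverse.
have m : measurable_fun [set: measurableTypeR R]
    (fun v => pos (pos_inverse v) - v : measurableTypeR R).
  apply: measurable_funB => //; first exact: (measurableT_comp mpos measurable_pos_inverse).
rewrite (_ : [set v | _] = (fun v => pos (pos_inverse v) - v) @^-1` [set 0]).
  by rewrite -[Z in measurable Z]setTI; exact: m.
by apply/seteqP; split => v /= [/eqP]; [rewrite -subr_eq0 => /eqP|rewrite subr_eq0 => /eqP].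
Qed.

Let Ypos x : X x -> Y (pos x).
Proof.
move=> Xx; have ix := X_interior Xx.
split; first by rewrite /= in_itv; exact: pos01.
by split; rewrite /= pos_inverseK//; exact: X01.
Qed.

Let posY v : Y v -> exists2 x, X x & pos x = v.
Proof. by move=> [_ [Xv pv]]; exists (pos_inverse v). Qed.

Let Tpos x : X x -> T (pos x) = pos (f x).
Proof.
by move=> Xx; rewrite /T mem_set ?pos_inverseK//; [exact: X_interior|exact: X01|exact: Ypos].
Qed.

Let Y_full : leb (I01 `\` Y) = 0%E.
Proof.
have mIY : mset (I01 `\` Y) by apply: measurableD => //; exact: measurable_itv.
have -> : leb (I01 `\` Y) = mu (pos @^-1` (I01 `\` Y)).
  by rewrite law//; congr (leb _); apply/esym/setIidPl => v [].
apply: (subset_measure0 _ _ _ X_full); [exact: mpre|exact: measurableC|].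
by move=> x [_ nY] Xx; apply: nY; exact: Ypos.
Qed.

Let mT : measurable_fun [set: measurableTypeR R] (T : _ -> measurableTypeR R).
Proof.
have m1 : measurable_fun [set: measurableTypeR R]
    (fun v => pos (f (pos_inverse v)) : measurableTypeR R).
  apply: (measurableT_comp mpos); apply: (measurableT_comp _ measurable_pos_inverse).
  exact: pf.1.
have m2 : measurable_fun [set: measurableTypeR R]
    (fun v => pos (f (pos_inverse v)) * \1_Y v : measurableTypeR R).
  by apply: measurable_funM => //; exact: measurable_indic.
apply: eq_measurable_fun m2 => v _; rewrite /T indicE.
by case: ifP; rewrite ?mulr1 ?mulr0.
Qed.

Let TI v : I01 (T v).
Proof.
rewrite /T /= in_itv /=; case: ifP => _; first exact: pos01.
by rewrite lexx ler01.
Qed.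

Let leb_law (B : set R) : mset B -> B `<=` I01 -> leb B = mu (pos @^-1` B).
Proof. by move=> mB BI; rewrite law//; congr (leb _); exact/esym/setIidPl. Qed.

Let leb_T : invariant_measure_on I01 leb T.
Proof.
move=> B mB BI.
have mTB : mset (I01 `&` T @^-1` B).
  by apply: measurableI; [exact: measurable_itv|rewrite -[Z in measurable Z]setTI; exact: mT].
apply: (etrans (leb_law mTB (@subIsetl _ _ _))).
apply: (etrans _ (esym (leb_law mB BI))); rewrite -(pf.2 _ (mpre mB)).
rewrite -(measureI_full mX X_full (mpre mTB)).
rewrite -[RHS](measureI_full mX X_full (preserves_measurable pf (mpre mB))).
congr (mu _); apply/seteqP; split => x [] /=.
  by move=> [_ TB] Xx; split => //; rewrite -Tpos.
by move=> Bf Xx; split => //; split; [rewrite in_itv; exact: pos01|rewrite Tpos].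
Qed.

Lemma transported_system : measure_preserving_system I01 leb T.
Proof.
split => //.
- apply: etrans (lebesgue_measure_itv `[0, 1]) _.
  by rewrite /= lte_fin ltr01 sube0.
- by apply: measurable_funTS; exact: mT.
- rewrite (_ : [set x | _] = set0); first exact: negligible_set0.
  by apply/seteqP; split => // x [_ nT]; exfalso; apply: nT; exact: TI.
Qed.

Lemma transported_conjugacy : exists (Y0 : set R) (Phi Psi : R -> R),
  [/\ [/\ mset Y0, Y0 `<=` I01, leb (I01 `\` Y0) = 0%E & forall y, Y0 y -> Y0 (T y)],
      [/\ set_bij X Y0 Phi, forall x, X x -> Psi (Phi x) = x,
          measurable_fun (X : set (measurableTypeR R))
            (Phi : measurableTypeR R -> measurableTypeR R) &
          measurable_fun (Y0 : set (measurableTypeR R))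
            (Psi : measurableTypeR R -> measurableTypeR R)],
      forall B : set R, mset B -> B `<=` Y0 -> mu (X `&` Phi @^-1` B) = leb B &
      forall x, X x -> Phi (f x) = T (Phi x)].
Proof.
have inv x : X x -> pos_inverse (pos x) = x.
  by move=> Xx; apply: pos_inverseK; [exact: X_interior|exact: X01].
exists Y, pos, pos_inverse; split.
- split => //; first by move=> v [].
  by move=> v /posY[x Xx <-]; rewrite Tpos//; apply: Ypos; exact: X_f.
- split => //.
  + split => [x|x y|v /posY[x Xx <-]]; [exact: Ypos| |by exists x].
    by move=> /set_mem Xx /set_mem Xy xy; rewrite -(inv x Xx) xy inv.
  + by apply: measurable_funTS; exact: mpos.
  + by apply: measurable_funTS; exact: measurable_pos_inverse.
- move=> B mB BY; rewrite leb_law//; last by move=> v /BY[].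
  by rewrite setIC measureI_full//; exact: mpre.
- by move=> x Xx; rewrite Tpos.
Qed.

(** The least length of a cylinder around [x] on which [f] translates. Being least, it is constant
    on that cylinder, so that these cylinders are pairwise equal or disjoint. *)
Let nu x := (first (fun n => `[< translates a f n x >])).-1.

Let nuP x : (exists n, translates a f n x) ->
  translates a f (nu x) x /\ forall i, translates a f i x -> (nu x <= i)%N.
Proof.
move=> [n tn]; have [|k [fk /asboolP tk kmin]] := @first_ex (fun n => `[< translates a f n x >]).
  by exists n; apply/asboolP.
rewrite /nu fk; split => // i ti; rewrite leqNgt; apply/negP => /kmin/negP; apply.
exact/asboolP.
Qed.

Let nu_agree x y : (exists n, translates a f n x) -> agree a (nu x) x y ->
  translates a f (nu x) y /\ nu y = nu x.
Proof.
move=> tx xy; have [tn nmin] := nuP tx; have ty := translates_agree tn xy; split => //.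
have [ty' ymin] := nuP (ex_intro (fun k => translates a f k y) (nu x) ty).
apply/eqP; rewrite eqn_leq ymin//=; apply: nmin.
apply: (translates_agree ty'); apply: agree_sym; apply: agreeW xy; exact: ymin.
Qed.

Let idx x := pickle (prefix_of a (nu x) x).

Let idxE x y : (exists n, translates a f n x) -> (exists n, translates a f n y) ->
  idx x = idx y <-> agree a (nu x) x y.
Proof.
move=> tx ty; split => [/(pcan_inj pickleK) E|xy].
  have nxy : nu x = nu y by rewrite -(size_prefix_of a (nu x) x) E size_prefix_of.
  by apply/prefix_of_inj; rewrite [in RHS]nxy.
by have [_ nxy] := nu_agree tx xy; rewrite /idx nxy; congr pickle; apply/prefix_of_inj.
Qed.

(** Cylinders of measure zero are left out, since the intervals must be nondegenerate. *)
Let is_rep m x := [/\ exists n, translates a f n x, lo (nu x) x < hi (nu x) x & idx x = m].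
Let D : set nat := [set m | exists x, is_rep m x].

(** Overlapping intervals thus contain the position of an actual point, which reduces their
    disjointness to that of cylinders. *)
Let pos_dense (c e : R) : 0 <= c -> e <= 1 -> c < e -> exists x, c < pos x < e.
Proof.
move=> c0 e1 ce; apply: contrapT => /forallNP H.
have mW : mset `]c, e[%classic by exact: measurable_itv.
have : leb `]c, e[%classic = 0%E.
  rewrite leb_law//; last first.
    move=> v /=; rewrite !in_itv/= => /andP[cv ve].
    by rewrite (le_trans c0 (ltW cv)) (le_trans (ltW ve) e1).
  rewrite (_ : _ @^-1` _ = set0) ?measure0//.
  by apply/seteqP; split => // x /=; rewrite in_itv; exact: H.
rewrite lebesgue_measure_itv /= lte_fin ce -EFinB => -[/eqP].
by rewrite subr_eq0 gt_eqF.
Qed.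

Lemma transported_countable_IET : countable_IET T.
Proof.
split; first by move=> v _; exact: TI.
  by apply: measurable_funTS; exact: mT.
have /choice[rep repP] : forall m, exists x, D m -> is_rep m x.
  move=> m; have [[x xm]|nDm] := pselect (D m); last by exists 0.
  by exists x.
pose n m := nu (rep m).
exists D, (fun m => lo (n m) (rep m)), (fun m => hi (n m) (rep m)),
  (fun m => lo (n m) (f (rep m)) - lo (n m) (rep m)) => U V.
have tr m : D m -> translates a f (n m) (rep m).
  by move=> /repP[tx _ _]; exact: (nuP tx).1.
have VE m : D m -> V m = `]lo (n m) (f (rep m)), hi (n m) (f (rep m))[%classic.
  by move=> Dm; rewrite /V (hi_translates ma pf (tr m Dm)) addrC subrK.
have sub x k : `]lo k x, hi k x[%classic `<=` I01.
  move=> v /=; rewrite !in_itv/= => /andP[lv vh].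
  by rewrite (le_trans (lo_ge0 _ _ _ _) (ltW lv)) (le_trans (ltW vh) (hi_le1 mu ma _ _)).
have agreeE m x : D m -> agree a (n m) (rep m) x -> (exists k, translates a f k x) /\ idx x = m.
  move=> Dm rx; have [tm _ <-] := repP m Dm; have [tx _] := nu_agree tm rx.
  by split; [exists (n m)|apply/esym/idxE => //; exists (n m)].
have hit (c1 e1 c2 e2 v : R) : 0 <= c1 -> e2 <= 1 -> v \in `]c1, e1[ -> v \in `]c2, e2[ ->
    exists x, c1 < pos x < e1 /\ c2 < pos x < e2.
  rewrite !in_itv/= => c0 e0 /andP[c1v ve1] /andP[c2v ve2].
  have [|||x] := @pos_dense (Num.max c1 c2) (Num.min e1 e2).
  - by rewrite le_max c0.
  - by rewrite ge_min e0 orbT.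
  - by rewrite lt_min !gt_max (lt_trans c1v ve1) (lt_trans c2v ve1)
      (lt_trans c1v ve2) (lt_trans c2v ve2).
  by rewrite lt_min !gt_max => /andP[/andP[p1 p2] /andP[p3 p4]]; exists x; rewrite p1 p2 p3 p4.
split.
- move=> m Dm; have [tm lh im] := repP m Dm; split => //; first exact: sub.
  by rewrite VE//; exact: sub.
- split => m m' Dm Dm' [v [vm vm']].
    have [x [xm xm']] := hit _ _ _ _ v (lo_ge0 _ _ _ _) (hi_le1 mu ma _ _) vm vm'.
    have [_ <-] := agreeE m x Dm (pos_between ma xm).
    by have [_ <-] := agreeE m' x Dm' (pos_between ma xm').
  move: vm vm'; rewrite !VE// => vm vm'.
  have [x [xm xm']] := hit _ _ _ _ v (lo_ge0 _ _ _ _) (hi_le1 mu ma _ _) vm vm'.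
  (* The translated intervals belong to the images of the cylinders, so the common point is brought
     back by [g]. *)
  have back k : D k -> agree a (n k) (f (rep k)) x -> agree a (n k) (rep k) (g x).
    by move=> Dk; rewrite -[x in agree _ _ _ x -> _]gf => /(tr k Dk).1.
  have [_ <-] := agreeE m (g x) Dm (back m Dm (pos_between ma xm)).
  by have [_ <-] := agreeE m' (g x) Dm' (back m' Dm' (pos_between ma xm')).
- have mU : mset (I01 `\` \bigcup_(m in D) U m).
    apply: measurableD; first exact: measurable_itv.
    by apply: bigcup_measurable => m _; exact: measurable_itv.
  rewrite leb_law//.
  apply: measure_negligible; first exact: mpre.
  have : \forall x \ae mu, ~ (pos @^-1` (I01 `\` \bigcup_(m in D) U m)) x.
    apply: ae_imp2 ae_int ae_translates => x ix tx [_]; apply.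
    have Dx : D (idx x).
      by exists x; split => //; have /andP[] := ix (nu x); exact: lt_trans.
    exists (idx x) => //; have [tr' _ ir] := repP _ Dx.
    have rx : agree a (n (idx x)) (rep (idx x)) x by apply/idxE.
    by rewrite /U /= in_itv (agree_lo mu rx) (agree_hi mu rx); exact: ix.
  by apply: negligibleS => x /= H K; exact: K.
- have mV : mset (I01 `\` \bigcup_(m in D) V m).
    apply: measurableD; first exact: measurable_itv.
    by apply: bigcup_measurable => m _; exact: measurable_itv.
  rewrite leb_law//.
  apply: measure_negligible; first exact: mpre.
  have : \forall x \ae mu, ~ (pos @^-1` (I01 `\` \bigcup_(m in D) V m)) x.
    (* The position of [x] is looked for in the translate of the interval of [g x]. *)
    apply: ae_imp2 ae_int (ae_preimage pg ae_translates) => x ix tx [_]; apply.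
    have [ty _] := nuP tx; have := hi_translates ma pf ty; rewrite gf => hE.
    have Dx : D (idx (g x)).
      exists (g x); split => //; have /andP[l h] := ix (nu (g x)).
      by have := lt_trans l h; rewrite hE; lra.
    exists (idx (g x)) => //; have [tr' _ ir] := repP _ Dx.
    have rx : agree a (n (idx (g x))) (rep (idx (g x))) (g x) by apply/idxE.
    have := ((tr _ Dx).1 (g x)).2 rx; rewrite gf => frx.
    by rewrite VE// /= in_itv (agree_lo mu frx) (agree_hi mu frx); exact: ix.
  by apply: negligibleS => x /= H K; exact: K.
(* Off the null set where [T] has its default value, a point of [U m] is the position of some [x] in
   the cylinder of [rep m]. *)
- move=> m Dm; exists (I01 `\` Y); split => //.
    by apply: measurableD => //; exact: measurable_itv.
  move=> v /= /not_implyP[Uv Tv]; split; first exact: sub Uv.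
  move=> /posY[x Xx px]; apply: Tv; rewrite -px Tpos//.
  apply: (pos_translates ma pf (tr m Dm)); apply: (pos_between ma (mu := mu)).
  by move: Uv; rewrite -px /U /= in_itv.
Qed.

End invariant_set.

End model.

(** * Interval translation maps *)

Section period.
Variable R : realType.
Implicit Types (f : R -> R) (x : R).

(** The shift in [first] makes this the least period itself, and 0 at aperiodic points. *)
Definition period f x : nat := first (fun k => `[< iter k.+1 f x = x >]).

Lemma period_eq0 f x : period f x = 0%N -> aperiodic f x.
Proof. by move=> /first_eq0 H p px; have /asboolP := H p. Qed.

Lemma period_gt0 f x : (0 < period f x)%N ->
  exists2 p, period f x = p.+1 & iter p.+1 f x = x.
Proof.
move=> px; have [|p [pe /asboolP pE _]] := @first_ex (fun k => `[< iter k.+1 f x = x >]).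
  apply: contrapT => /forallNP H; move: px; rewrite /period (first_eq0 _).2// => k.
  exact/negP/H.
by exists p.
Qed.

Lemma period_f f x : injective f -> period f (f x) = period f x.
Proof.
move=> inj; rewrite /period; congr first; apply/funext => k.
apply/asbool_equiv_eq; rewrite -iterSr iterS; split; last by move=> ->.
exact: inj.
Qed.

Lemma period_low_points f n x k : (0 < period f x <= n)%N ->
  low_points f n x -> low_points f n (iter k f x) -> iter k f x = x.
Proof.
by move=> /andP[/period_gt0[p -> px] pn]; exact: low_points_periodic px.
Qed.

Lemma period_low_points_all f n x i : (0 < period f x <= n)%N ->
  low_points f n x -> low_points f i x.
Proof.
move=> /andP[/period_gt0[p -> px] pn] Bx l _.
have per k : iter (k * p.+1) f x = x by elim: k => // k IH; rewrite mulSn iterD IH.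
rewrite (divn_eq l p.+1) addnC iterD per; apply: Bx.
by rewrite (leq_trans _ pn)// ltnW// ltn_mod.
Qed.

Lemma measurable_period (mu : probability (measurableTypeR R) R) f :
  preserves mu f -> @measurable_fibers _ (measurableTypeR R) _ (period f).
Proof.
move=> pf; apply: (@measurable_fibers_first _ (measurableTypeR R)) => k.
have m : measurable_fun [set: measurableTypeR R] (fun x => iter k.+1 f x - x : measurableTypeR R).
  by apply: measurable_funB => //; exact: (preserves_iter pf k.+1).1.
rewrite (_ : [set x | _] = (fun x => iter k.+1 f x - x) @^-1` [set 0]).
  by rewrite -[Z in measurable Z]setTI; exact: m.
apply/seteqP; split => x /=; first by move=> /asboolP ->; rewrite subrr.
by move=> /eqP; rewrite subr_eq0 => /eqP ?; apply/asboolP.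
Qed.

Lemma automorphism_digits (mu : probability (measurableTypeR R) R) f g :
  automorphism mu f g ->
  (forall n x, exists r, low_points f n (iter r f x)) ->
  (forall n x, exists j, low_points f n (iter j g x)) ->
  exists a : nat -> R -> nat,
    [/\ forall i, @measurable_fibers _ (measurableTypeR R) _ (a i),
        forall k, exists n, forall x y, agree a n x y ->
          x < rational_seq R k -> y < rational_seq R k &
        \forall x \ae mu, exists n, translates a f n x].
Proof.
move=> autf toB fromB; have [pf pg fg gf] := autf.
pose E k : set R := [set x | x < rational_seq R k].
have mE k : @measurable _ (measurableTypeR R) (E k).
  rewrite (_ : E k = `]-oo, rational_seq R k[%classic); first exact: measurable_itv.
  by apply/seteqP; split => x /=; rewrite in_itv.
have dec m n : (m <= n)%N -> low_points f n `<=` low_points f m by exact: low_pointsS.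
have perf x : period f (f x) = period f x by apply: period_f; exact: can_inj fg.
exists (digit f g (low_points f) E (period f)); split.
- move=> i; apply: (@measurable_digit _ (measurableTypeR R)) => //.
  + exact: pf.1.
  + exact: pg.1.
  + by move=> n; exact: measurable_low_points pf.
  + exact: measurable_period pf.
- by move=> k; exists k.+1.*2 => x y; exact: digits_determine_E.
- apply: ae_imp (ae_aperiodic_not_low autf) => x apx.
  apply: translates_digit => //.
  + by move=> n y k; exact: period_low_points.
  + by move=> n y i; exact: period_low_points_all.
  + by move=> /period_eq0; exact: apx.
Qed.

End period.

Section support.
Variables (R : realType) (mu : probability (measurableTypeR R) R).

Lemma nonatomic_points : nonatomic mu -> forall x, mu [set x] = 0%E.
Proof.
move=> na x; apply/eqP; apply: contrapT => /negP x0; apply: (na [set x]).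
split => //; first by rewrite measure_gt0.
by move=> B _ /subset_set1[->|->]; [left; rewrite measure0|right].
Qed.

Lemma measurable_support : @measurable _ (measurableTypeR R) (measure_support mu).
Proof.
rewrite -[X in measurable X]setCK; apply: measurableC; apply: open_measurable.
rewrite openE => x /= /existsNP[U /not_implyP[oU /not_implyP[Ux U0]]].
rewrite /interior; apply: (@filterS _ _ _ U); last exact: open_nbhs_nbhs.
by move=> y Uy Hy; apply: U0; exact: Hy.
Qed.

(** A point off the support lies in a null interval with rational ends, and there are countably many
    of these. *)
Lemma support_full : mu (~` measure_support mu) = 0%E.
Proof.
apply: measure_negligible; first by apply: measurableC; exact: measurable_support.
pose I (k : nat) : set R :=
  if unpickle k is Some (p, q) then `](ratr p : R), ratr q[%classic else set0.
pose J k := if mu (I k) == 0%E then I k else set0.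
apply: (@negligibleS _ _ _ mu (\bigcup_k J k)); last first.
  apply: negligible_bigcup => k; rewrite /J; case: eqP => [I0|_]; last exact: negligible_set0.
  by apply/negligibleP => //; rewrite /I; case: unpickle => // -[p q]; exact: measurable_itv.
move=> x /= /existsNP[U /not_implyP[oU /not_implyP[Ux U0]]].
have {}U0 : mu U = 0%E.
  by apply/eqP; apply: contrapT => /negP H; apply: U0; rewrite measure_gt0.
have : nbhs x U by exact: open_nbhs_nbhs.
rewrite -nbhs_ballE => -[e /= e0 eU].
have xe : x - e < x by rewrite ltrBlDr ltrDl.
have ex : x < x + e by rewrite ltrDl.
have [p] := rat_in_itvoo xe; have [q] := rat_in_itvoo ex.
rewrite !in_itv/= => /andP[xq qe] /andP[ep px].
have Ipq : I (pickle (p, q)) = `](ratr p : R), ratr q[%classic by rewrite /I pickleK.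
exists (pickle (p, q)) => //; rewrite /J Ipq ifT /=; first by rewrite in_itv /= px xq.
rewrite -measure_le0 -[leRHS]U0 le_measure ?inE//; first exact: open_measurable.
move=> y; rewrite /= in_itv/= => /andP[py yq]; apply: eU; rewrite /ball /= ltr_norml.
by apply/andP; split; lra.
Qed.

End support.

Section interval_translation_maps.
Variables (R : realType) (S : R -> R).
Hypothesis itmS : interval_translation_map S.
Local Notation I := (`[0, 1[%classic : set R).

(** Nothing is known of [S] off [0, 1). The identity there adds only the displacement 0. *)
Definition extended (x : R) : R := if x \in I then S x else x.

Lemma extendedE x : I x -> extended x = S x.
Proof. by move=> Ix; rewrite /extended mem_set. Qed.

Lemma extendedN x : ~ I x -> extended x = x.
Proof. by move=> Ix; rewrite /extended memNset. Qed.

Lemma itm_pieces : exists (n : nat) (t c : nat -> R),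
  (forall x, I x -> exists2 k, (k < n)%N & x \in `[t k, t k.+1[) /\
  (forall k x, (k < n)%N -> x \in `[t k, t k.+1[ -> S x = x + c k /\ I (x + c k)).
Proof.
have [n [t [c [t0 tn tlt Sc]]]] := itmS; exists n, t, c; split; last by move=> k x /Sc; exact.
move=> x; rewrite /= in_itv /= -t0 -tn.
elim: (n) => [|m IH] /andP[x0 xm]; first by move: (le_lt_trans x0 xm); rewrite ltxx.
have [xtm|tmx] := ltP x (t m); last by exists m; rewrite // in_itv /= tmx.
by have [|k km xk] := IH; [rewrite x0|exists k => //; exact: leqW].
Qed.

Lemma extended_displacements : exists cs : seq R, forall x, extended x - x \in cs.
Proof.
have [n [t [c [cover Sc]]]] := itm_pieces.
exists (0 :: [seq c k | k <- iota 0 n]) => x; rewrite inE.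
have [Ix|nIx] := pselect (I x); last by rewrite extendedN// subrr eqxx.
apply/orP; right; have [k kn xk] := cover x Ix.
rewrite extendedE//; have [-> _] := Sc k x kn xk; rewrite addrAC subrr add0r.
by apply: map_f; rewrite mem_iota.
Qed.

Lemma itm_maps x : I x -> I (S x).
Proof.
have [n [t [c [cover Sc]]]] := itm_pieces => /cover[k kn xk].
by have [->] := Sc k x kn xk.
Qed.

Lemma measurable_extended :
  measurable_fun [set: measurableTypeR R] (extended : _ -> measurableTypeR R).
Proof.
have [n [t [c [cover Sc]]]] := itm_pieces.
move=> _ B mB; rewrite setTI.
rewrite (_ : extended @^-1` B = (\bigcup_(k in [set k | (k < n)%N])
    ((I `&` `[t k, t k.+1[%classic) `&` [set x | B (x - - c k)])) `|` (B `\` I)).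
  apply: measurableU; last by apply: measurableD => //; exact: measurable_itv.
  apply: bigcup_measurable => k _; apply: measurableI; last exact: measurable_translate.
  by apply: measurableI; exact: measurable_itv.
apply/seteqP; split => x.
  have [Ix|nIx] := pselect (I x); last by rewrite /= extendedN//; right.
  rewrite /= extendedE// => BSx; left; have [k kn xk] := cover x Ix.
  by exists k => //; split => //=; rewrite opprK; have [<-] := Sc k x kn xk.
case=> [[k kn [[Ix xk] /=]]|[Bx nIx]]; last by rewrite /= extendedN.
by rewrite opprK extendedE//; have [->] := Sc k x kn xk.
Qed.

Variable mu : probability (measurableTypeR R) R.
Hypothesis mu01 : mu I = 1%E.
Hypothesis invS : invariant_measure_on I mu S.

Let mI : @measurable _ (measurableTypeR R) I.
Proof. exact: measurable_itv. Qed.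

Let I_full : mu (~` I) = 0%E.
Proof. exact: measureC_full. Qed.

Lemma extended_preserves : preserves mu extended.
Proof.
split; first exact: measurable_extended.
move=> B mB.
have mSB : @measurable _ (measurableTypeR R) (extended @^-1` B).
  by rewrite -[X in measurable X]setTI; exact: measurable_extended.
rewrite -(measureI_full mI I_full mSB) -[RHS](measureI_full mI I_full mB).
rewrite -[RHS]invS; [|exact: measurableI|by move=> x []].
congr (mu _); apply/seteqP; split => x.
  by move=> [/= + Ix]; rewrite extendedE// => BSx; split => //; split => //; exact: itm_maps.
by move=> [Ix [BSx _]]; split => //=; rewrite extendedE.
Qed.

Lemma support_subset : measure_support mu `<=` `[0, 1]%classic.
Proof.
move=> x xs; apply: contrapT => nx.
have oC : open (~` `[0, 1]%classic : set R) by apply: closed_openC; exact: itv_closed.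
have := xs _ oC nx.
rewrite ltNge => /negP; apply.
rewrite -I_full le_measure ?inE//.
- by apply: measurableC; exact: measurable_itv.
- exact: measurableC.
by apply: subsetC => y /=; rewrite !in_itv/= => /andP[-> /ltW].
Qed.

Lemma itm_support_system : measure_preserving_system (measure_support mu) mu S.
Proof.
have ms := measurable_support mu; have s0 := support_full mu.
have [_ inv_ext] := extended_preserves.
have mus : mu (measure_support mu) = 1%E.
  by rewrite -[RHS](probability_setT mu) -[RHS](measureI_full ms s0 measurableT) setTI.
have msI : @measurable _ (measurableTypeR R) (measure_support mu `&` I) by exact: measurableI.
have sI0 : mu (~` (measure_support mu `&` I)) = 0%E.
  apply: measure_negligible; first exact: measurableC.
  by rewrite setCI; apply: negligibleU; apply/negligibleP => //; exact: measurableC.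
have mpre (B : set R) : @measurable _ (measurableTypeR R) B ->
    @measurable _ (measurableTypeR R) (extended @^-1` B).
  by move=> mB; rewrite -[X in measurable X]setTI; exact: measurable_extended.
have mS : measurable_fun (measure_support mu : set (measurableTypeR R))
    (S : measurableTypeR R -> measurableTypeR R).
  move=> _ B mB.
  (* The support may contain 1, where [S] is arbitrary, so this point is treated apart. *)
  rewrite (_ : _ `&` _ = ((measure_support mu `&` I) `&` extended @^-1` B) `|`
      ((measure_support mu `&` [set 1]) `&` (if `[< B (S 1) >] then setT else set0))).
    apply: measurableU; first by apply: measurableI => //; exact: mpre.
    by apply: measurableI; [exact: measurableI|case: ifP].
  apply/seteqP; split => x.
    move=> [xs /= BSx]; have [Ix|nIx] := pselect (I x).
      by left; split => //=; rewrite extendedE.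
    right; suff x1 : x = 1.
      by rewrite x1 in xs BSx *; split => //; rewrite ifT//; exact/asboolP.
    have /= := support_subset xs; move: nIx; rewrite /= !in_itv/=.
    by move=> /negP; rewrite negb_and -!leNgt -ltNge => + /andP[x0 x1]; rewrite ltNge x0 /= => ?;
      apply/eqP; rewrite eq_le x1.
  case=> [[[xs Ix] /=]|[[xs x1]]]; first by rewrite extendedE.
  by case: ifP => // /asboolP BS1 _; rewrite x1 in xs *.
have mu_pre (B : set R) : @measurable _ (measurableTypeR R) B ->
    mu (measure_support mu `&` S @^-1` B) = mu B.
  move=> mB; rewrite -(inv_ext _ mB).
  rewrite -(measureI_full msI sI0 (mS ms _ mB)) -[RHS](measureI_full msI sI0 (mpre _ mB)).
  congr (mu _); apply/seteqP; split => x.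
    by move=> [[xs /= BSx] [_ Ix]]; split => //=; rewrite extendedE.
  by move=> [/= + [xs Ix]]; rewrite extendedE.
split => //.
- exists (measure_support mu `&` S @^-1` (~` measure_support mu)); split.
  + by apply: mS => //; exact: measurableC.
  + by apply: etrans (mu_pre _ _) _ => //; exact: measurableC.
  + by move=> x [].
- by move=> B mB _; exact: mu_pre.
Qed.

End interval_translation_maps.

Theorem corollary3p11 (R : realType) (S : R -> R)
    (mu : probability (measurableTypeR R) R)
    (hS : interval_translation_map S)
    (hmu01 : mu `[0, 1[%classic = 1%E)
    (hinv : invariant_measure_on `[0, 1[%classic mu S)
    (hna : nonatomic mu) :
  exists T : R -> R,
    countable_IET T /\
    metrically_equivalent (measure_support mu) mu S
                          `[0, 1]%classic (@lebesgue_measure R) T.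
Proof.
set I : set R := `[0, 1[%classic in hmu01 hinv.
have mI : @measurable _ (measurableTypeR R) I by exact: measurable_itv.
have I0 : mu (~` I) = 0%E by exact: measureC_full.
have ps := extended_preserves hS hmu01 hinv.
have [cs scs] := extended_displacements hS.
have [A [mA A0 injA]] := essentially_injective ps scs.
have [Y [f0 [g0 [mY Y0 aut0 f0E]]]] :=
  bijective_part ps (measurable_image ps scs) mA A0 injA.
have [X [f [g [[mX X0 XY Xf] autf fE toB fromB]]]] :=
  everywhere_recurrent_version aut0 mY Y0.
have [a [ma bits aet]] := automorphism_digits autf toB fromB.
have pts := nonatomic_points hna.
have ms := measurable_support mu.
have mXIs : @measurable _ (measurableTypeR R) (X `&` (I `&` measure_support mu)).
  by apply: measurableI => //; exact: measurableI.
have XIs0 : mu (~` (X `&` (I `&` measure_support mu))) = 0%E.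
  apply: measure_negligible; first exact: measurableC.
  rewrite !setCI; apply: negligibleU; first by apply/negligibleP => //; exact: measurableC.
  apply: negligibleU; apply/negligibleP; [exact: measurableC|by []|exact: measurableC|].
  exact: support_full.
have a_null x : mu [set y | forall i, a i x = a i y] = 0%E.
  exact: digits_separate.
have [Z [mZ Z0 ZP]] := ae_full_set (ae_imp2 (fun _ => @conj _ _)
  (full_set_ae mXIs XIs0) (ae_interior ma a_null)).
(* Invariance lets [X1] be the domain of the conjugacy; on it [S] agrees with [f], and positions are
   interior to the intervals of their cylinders. *)
have [X1 [mX1 X10 X1Z X1f _]] := invariant_core autf mZ Z0.
have X1P x : X1 x -> [/\ X x, I x, measure_support mu x & S x = f x].
  move=> /X1Z/ZP[[Xx [Ix sx]] _]; split => //.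
  by rewrite fE// f0E ?extendedE//; exact: XY.
have X1_interior x : X1 x -> forall n, lo mu a n x < pos mu a x < hi mu a n x.
  by move=> /X1Z/ZP[].
have X101 x : X1 x -> 0 <= x < 1 by move=> /X1P[_ + _ _]; rewrite /I /= in_itv.
have [Y0' [Phi [Psi [H1 H2 H3 H4]]]] :=
  transported_conjugacy ma bits pts mX1 X10 X1f X1_interior X101.
exists (transported mu f bits X1); split.
  exact: (transported_countable_IET autf ma bits pts aet mX1 X10 X1_interior X101).
split.
- exact: itm_support_system.
- exact: (transported_system autf ma bits pts mX1 X10 X1_interior X101).
exists X1, Y0', Phi, Psi; split => //.
- split => //.
  + by move=> x /X1P[].
  + apply: (subset_measure0 _ _ _ X10); [exact: measurableD|exact: measurableC|].
    by move=> x [].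
  + by move=> x X1x; have [_ _ _ ->] := X1P x X1x; exact: X1f.
- by move=> x X1x; have [_ _ _ ->] := X1P x X1x; exact: H4.
Qed.
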